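(* The following are equivalent: (1) Turing equivalence $\equiv_T$ on $2^\omega$ is hyper-recursively-finite. (2) Every countable Borel equivalence relation $E$ (on a standard Borel space) is hyper-Borel-finite.
   Context: A Borel equivalence relation is countable if all of its classes are countable. $[x]_F$ denotes the $F$-class of $x$. Let $X$ be a standard Borel space and $(f_i)_{i\in\omega}$ a countable sequence of Borel functions $f_i\colon X\to X^\omega$. A countable Borel equivalence relation $F$ on $X$ is $(f_i)_{i\in\omega}$-finite if there are no $i\in\omega$ and $x\in X$ such that the set $\{f_i(x)(j): j\in\omega\}$ is infinite and $\{f_i(x)(j): j\in\omega\}\subseteq [x]_F$. A countable Borel equivalence relation $E$ on $X$ is hyper-$(f_i)_{i\in\omega}$-finite if there is an increasing sequence $F_0\subseteq F_1\subseteq\cdots$ of Borel subequivalence relations of $E$ such that every $F_n$ is $(f_i)_{i\in\omega}$-finite and $\bigcup_n F_n=E$. $E$ is hyper-Borel-finite if for every countable collection $(f_i)_{i\in\omega}$ of Borel functions $f_i\colon X\to X^\omega$, $E$ is hyper-$(f_i)_{i\in\omega}$-finite. Fix a computable bijection $\langle\cdot,\cdot\rangle\colon\omega^2\to\omega$ and let $\Phi_i$ denote the $i$th Turing reduction (with output regarded as an element of $2^\omega$, i.e. a subset of $\omega$, when total). Define $f_i\colon 2^\omega\to(2^\omega)^\omega$ by $f_i(x)(j)=\{n: \langle j,n\rangle\in\Phi_i(x)\}$ if $\Phi_i(x)$ is total, and $f_i(x)(j)=x$ otherwise. Turing equivalence $\equiv_T$ is hyper-recursively-finite if it is hyper-$(f_i)_{i\in\omega}$-finite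 for this particular sequence $(f_i)_{i\in\omega}$. *)

(* Defs.v *)
From HB Require Import structures.
From mathcomp Require Import all_boot all_order all_algebra.
From mathcomp Require Import all_classical all_reals topology cantor measure.

Set Implicit Arguments.
Unset Strict Implicit.
Unset Printing Implicit Defensive.

Local Open Scope classical_set_scope.

(** * Standard Borel spaces and Borel equivalence relations *)

Definition polish (R : realType) (P : metricType R) : Prop :=
  (forall F : set_system P,
     ProperFilter F -> cauchy F -> exists p : P, F --> p) /\
  (exists2 D : set P, countable D & dense D).

(* [h] transports a Polish topology to [X]; its Borel sets are exactly the
   measurable sets of [X]. *)
Definition standard_borel (R : realType) d (X : measurableType d) : Prop :=
  exists (P : metricType R) (h : X -> P),
    [/\ polish P, bijective h &
        forall A : set X, measurable A <-> <<s (@open P) >> (h @` A)].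

Section BorelEquivalence.
Context {d : measure_display} {X : measurableType d}.
Implicit Types (E F : X -> X -> Prop) (f : nat -> X -> nat -> X).

Definition seq_cylinder : set (set (nat -> X)) :=
  \bigcup_(j in [set: nat])
    preimage_set_system [set: nat -> X] (fun u => u j) measurable.

(* The codomain X^omega carries the product sigma-algebra. *)
Definition borel_seq_fun (g : X -> nat -> X) : Prop :=
  measurable_fun [set: X] (g : X -> g_sigma_algebraType seq_cylinder).

(* The [F]-class of [x] is the set [F x]. *)
Definition countable_borel_equivalence E : Prop :=
  [/\ RelationClasses.Equivalence E,
      measurable [set p : X * X | E p.1 p.2] &
      forall x, countable (E x)].

Definition seq_finite f F : Prop :=
  ~ exists i x, infinite_set (range (f i x)) /\ range (f i x) `<=` F x.

Definition hyper_seq_finite f E : Prop :=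
  exists F : nat -> X -> X -> Prop,
    [/\ forall n, countable_borel_equivalence (F n),
        forall n x y, F n x y -> E x y,
        forall n x y, F n x y -> F n.+1 x y,
        forall n, seq_finite f (F n) &
        forall x y, E x y <-> exists n, F n x y].

Definition hyper_borel_finite E : Prop :=
  forall f, (forall i, borel_seq_fun (f i)) -> hyper_seq_finite f E.

End BorelEquivalence.

(** * Turing reductions *)

(* Kleene's partial recursive functionals: programs for the number-theoretic
   functions that are partial recursive in an oracle. *)
Unset Elimination Schemes.
Inductive program : Type :=
| PZero
| PSucc
| PProj of nat
| POracle
| PComp of program & seq program
| PRec of program & program
| PMin of program.
Set Elimination Schemes.

(* [oracle_eval x c s v]: with oracle [x], the program [c] halts on the arguments [s]
   with value [v]. Missing arguments are read as 0. *)
Fixpoint oracle_eval (x : nat -> bool) (c : program) (s : seq nat) (v : nat) : Prop :=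
  match c with
  | PZero => v = 0
  | PSucc => v = (head 0 s).+1
  | PProj i => v = nth 0 s i
  | POracle => v = x (head 0 s)
  | PComp f gs =>
      exists2 vs : seq nat,
        (fix evals (hs : seq program) (ws : seq nat) : Prop :=
           match hs, ws with
           | [::], [::] => True
           | h :: hs', w :: ws' => oracle_eval x h s w /\ evals hs' ws'
           | _, _ => False
           end) gs vs
        & oracle_eval x f vs v
  | PRec f g =>
      (fix rec (n w : nat) : Prop :=
         if n is m.+1
         then exists2 u, rec m u & oracle_eval x g [:: m, u & behead s] w
         else oracle_eval x f (behead s) w) (head 0 s) v
  | PMin f =>
      oracle_eval x f (v :: s) 0 /\
      (forall m, m < v -> exists u, oracle_eval x f (m :: s) u.+1)
  end.

(* The Goedel numbering of programs goes through the one of finite trees. *)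
Fixpoint tree_of_program (c : program) : GenTree.tree nat :=
  match c with
  | PZero => GenTree.Node 0 [::]
  | PSucc => GenTree.Node 1 [::]
  | PProj i => GenTree.Leaf i
  | POracle => GenTree.Node 2 [::]
  | PComp f gs =>
      GenTree.Node 3 (tree_of_program f :: map tree_of_program gs)
  | PRec f g => GenTree.Node 4 [:: tree_of_program f; tree_of_program g]
  | PMin f => GenTree.Node 5 [:: tree_of_program f]
  end.

Fixpoint program_of_tree (t : GenTree.tree nat) : program :=
  match t with
  | GenTree.Leaf i => PProj i
  | GenTree.Node 1 _ => PSucc
  | GenTree.Node 2 _ => POracle
  | GenTree.Node 3 (f :: gs) =>
      PComp (program_of_tree f) (map program_of_tree gs)
  | GenTree.Node 4 [:: f; g] => PRec (program_of_tree f) (program_of_tree g)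
  | GenTree.Node 5 [:: f] => PMin (program_of_tree f)
  | _ => PZero
  end.

Lemma tree_of_programK : cancel tree_of_program program_of_tree.
Proof.
rewrite /cancel; fix IH 1; case=> [||i||f gs|f g|f] //=.
- rewrite IH; congr PComp.
  by elim: gs => //= g gs ->; rewrite IH.
- by rewrite !IH.
- by rewrite IH.
Qed.

HB.instance Definition _ := Countable.copy program (can_type tree_of_programK).

Definition nth_program (i : nat) : program := odflt PZero (unpickle i).

Definition Phi_total (i : nat) (x : cantor_space) : Prop :=
  forall n, exists v, oracle_eval x (nth_program i) [:: n] v.

(* Phi_i(x) as a subset of omega, any nonzero output meaning membership. *)
Definition Phi (i : nat) (x : cantor_space) : cantor_space :=
  fun n => `[< exists2 v, oracle_eval x (nth_program i) [:: n] v & v != 0 >].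

Definition turing_le (y x : cantor_space) : Prop :=
  exists2 i, Phi_total i x & Phi i x = y.

Notation borel_cantor := (g_sigma_algebraType (@open cantor_space)).

Definition turing_equiv (x y : borel_cantor) : Prop :=
  turing_le x y /\ turing_le y x.

Definition computable_bijection (pairing : nat -> nat -> nat) : Prop :=
  bijective (fun p : nat * nat => pairing p.1 p.2) /\
  exists c, forall j n, oracle_eval (fun=> false) c [:: j; n] (pairing j n).

Definition turing_seq (pairing : nat -> nat -> nat) (i : nat) (x : borel_cantor)
    (j : nat) : borel_cantor :=
  if `[< Phi_total i x >] then (fun n => Phi i x (pairing j n)) else x.

Definition hyper_recursively_finite (pairing : nat -> nat -> nat) : Prop :=
  hyper_seq_finite (turing_seq pairing) turing_equiv.

(* Main.v *)
Require Import Defs.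
From HB Require Import structures.
From mathcomp Require Import all_boot all_order all_algebra.
From mathcomp Require Import all_classical all_reals topology cantor measure.

Set Implicit Arguments.
Unset Strict Implicit.
Unset Printing Implicit Defensive.

Import Order.TTheory GRing.Theory Num.Theory.

Local Open Scope classical_set_scope.

(** If every countable Borel equivalence relation is hyper-Borel-finite, then so
    is Turing equivalence, because it is a countable Borel equivalence relation
    ([turing_countable_borel]) on a standard Borel space
    ([standard_borel_cantor]) and the sequences attached to the reductions are
    Borel ([borel_turing_seq]).

    Conversely, let [E] be a countable Borel equivalence relation on [X] and let
    [f i] be Borel maps from [X] to sequences in [X]. It suffices to find an
    injective Borel map [phi] from [X] to the Cantor space such that [E]-equivalent
    points have Turing equivalent images, and such that for each [i] one reduction
    computes from [phi x] all the [phi (f i x j)], uniformly in [j]. For then an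
    exhaustion of Turing equivalence by relations [F n] that are finite for the
    reductions pulls back along [phi] to an exhaustion of [E] by relations that
    are finite for the [f i].

    To build [phi], choose countably many Borel functions [g n] whose graphs cover
    [E] ([countable_borel_graphs]). The oracle [phi x] lists the answers to a
    countable stock of Borel questions about [x]. The stock contains questions
    that determine [x], and it is closed under substituting for [x] any [g n x] or
    [f i x j]. So the oracle of [g n x] or of [f i x j] is a column of the oracle
    of [x]; the numbers of the columns needed for [f i] depend on [j] only, and
    they are stored in the oracle as well ([answer], [Phi_answers]).

    The functions [g n] come from the Lusin-Novikov theorem ([lusin_novikov]): a
    Borel set with countable sections is covered by countably many graphs of Borel
    functions. It is proved by constructing a perfect set inside a single section
    if there is no such cover. Finite approximations to the perfect set are kept
    good, meaning that no countable family of Borel functions meets all the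
    configurations they describe. A good approximation can be split further
    ([split_node]), since a node that cannot be split describes a function, and
    such a function extends to a Borel one by Lusin's separation theorem
    ([lusin_separation]). *)

(** * Sigma-algebras and logical connectives *)

(** The closure rules of a sigma-algebra, phrased for the logical connectives, so
    that the measurability of a set can be read off from the formula defining
    it. *)
Section SigmaAlgebra.
Context {T : Type} {M : set_system T}.
Hypothesis saM : sigma_algebra [set: T] M.
Implicit Types P Q : set T.

Lemma sa_not P : M P -> M [set x | ~ P x].
Proof. by case: saM => _ MC _ /MC; rewrite setTD. Qed.

Lemma sa_exists (K : countType) (P : K -> set T) :
  (forall k, M (P k)) -> M [set x | exists k, P k x].
Proof.
case: saM => M0 _ MU MP.
pose F n := if unpickle n is Some k then P k else set0.
have -> : [set x | exists k, P k x] = \bigcup_n F n.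
  apply/seteqP; split=> [x [k Pkx]|x [n _]].
    by exists (pickle k) => //; rewrite /F pickleK.
  by rewrite /F; case: unpickle => // k Pkx; exists k.
by apply: MU => n; rewrite /F; case: unpickle.
Qed.

Lemma sa_forall (K : countType) (P : K -> set T) :
  (forall k, M (P k)) -> M [set x | forall k, P k x].
Proof.
move=> MP; have -> : [set x | forall k, P k x] =
    [set x | ~ exists k, ~ P k x].
  by apply/predeqP => x; split=> [Px [k]|/forallNP Px k]; [exact|exact: contrapT].
by apply: sa_not; apply: sa_exists => k; exact: sa_not.
Qed.

Lemma sa_cst (p : Prop) : M [set _ | p].
Proof.
case: saM => M0 MC _; have [hp|np] := pselect p.
  suff -> : [set _ : T | p] = setT `\` set0 by apply: MC.
  by rewrite setD0; apply/predeqP.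
suff -> : [set _ : T | p] = set0 by [].
by apply/predeqP => x; split.
Qed.

Lemma sa_and P Q : M P -> M Q -> M [set x | P x /\ Q x].
Proof.
move=> MP MQ; have -> : [set x | P x /\ Q x] =
    [set x | forall b : bool, if b then P x else Q x].
  apply/predeqP => x; split=> [[Px Qx] []//|PQ].
  by split; [exact: (PQ true)|exact: (PQ false)].
by apply: sa_forall => -[].
Qed.

Lemma sa_imp (p : Prop) Q : M Q -> M [set x | p -> Q x].
Proof.
have [hp|np] := pselect p => MQ.
  suff -> : [set x | p -> Q x] = Q by [].
  by apply/predeqP => x; split=> [/(_ hp)|Qx _].
suff -> : [set x | p -> Q x] = [set x | True] by exact: sa_cst.
by apply/predeqP => x; split=> // _ /np.
Qed.

Lemma sa_or P Q : M P -> M Q -> M [set x | P x \/ Q x].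
Proof.
move=> MP MQ; have -> : [set x | P x \/ Q x] =
    [set x | exists b : bool, if b then P x else Q x].
  apply/predeqP => x /=; split=> [[Px|Qx]|[[] ?]]; last by right.
  - by exists true.
  - by exists false.
  - by left.
by apply: sa_exists => -[].
Qed.

Lemma sa_preim (S : Type) (G : set_system S) (f : T -> S) :
  (forall U, G U -> M (f @^-1` U)) -> forall U, <<s G >> U -> M (f @^-1` U).
Proof.
move=> GM U sU; apply: (sU [set V | M (f @^-1` V)]); split; last exact: GM.
split=> /=.
- by rewrite preimage_set0; case: saM.
- by move=> B MB; rewrite setTD; exact: sa_not.
- move=> B MB; case: saM => _ _ MU.
  by rewrite preimage_bigcup; exact: MU.
Qed.

End SigmaAlgebra.

(** * Spaces of sequences *)

(** Only spaces [nat -> A] with [A] countable occur below: a point of a product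
    is represented by the sequence of the pairs of entries ([zip_seq]), and
    Baire space is the case [A = nat]. *)
Definition coord_sets (A : Type) : set_system (nat -> A) :=
  [set U | exists i a, U = [set x | x i = a]].

Definition borel_seq (A : Type) : set_system (nat -> A) := <<s @coord_sets A >>.

Lemma borel_seq_sa (A : Type) : sigma_algebra [set: nat -> A] (@borel_seq A).
Proof. exact: smallest_sigma_algebra. Qed.

Lemma borel_seq_preim (T : Type) (M : set_system T) (A : Type)
    (f : T -> nat -> A) :
  sigma_algebra [set: T] M -> (forall i a, M [set t | f t i = a]) ->
  forall U, borel_seq U -> M (f @^-1` U).
Proof.
by move=> saM Mf; apply: sa_preim => // _ [i [a ->]]; exact: Mf.
Qed.

Lemma borel_coord (A : countType) (i : nat) (p : A -> Prop) :
  borel_seq [set x : nat -> A | p (x i)].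
Proof.
have -> : [set x : nat -> A | p (x i)] =
    [set x | exists a, p a /\ x i = a].
  by apply/predeqP => x /=; split=> [px|[a [pa ->]]//]; exists (x i).
apply: (sa_exists (borel_seq_sa A)) => a.
apply: (sa_and (borel_seq_sa A)); first exact: sa_cst (borel_seq_sa A) _.
by apply: sub_sigma_algebra; exists i, a.
Qed.

Definition agree (A : Type) n (x y : nat -> A) := forall i, (i < n)%N -> x i = y i.

(** Closedness for the product of the discrete topologies: [R] contains every
    sequence all of whose prefixes are prefixes of members of [R]. *)
Definition seq_closed (A : Type) (R : set (nat -> A)) :=
  forall x, (forall n, exists2 y, agree n x y & R y) -> R x.

Definition zip_seq (A B : Type) (x : nat -> A) (z : nat -> B) : nat -> A * B :=
  fun n => (x n, z n).

(** Projections of closed sets along Baire space. *)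
Definition analytic (A : Type) (P : set (nat -> A)) :=
  exists2 R : set (nat -> A * nat), seq_closed R &
    forall x, P x <-> exists z, R (zip_seq x z).

Section Analytic.
Context {A : Type}.
Implicit Types P : set (nat -> A).

(** The first entry of the witness tells which of the sets is meant, the rest is
    a witness for that set. *)
Lemma analytic_bigcup (P : nat -> set (nat -> A)) :
  (forall k, analytic (P k)) -> analytic [set x | exists k, P k x].
Proof.
move=> /(_ _)/cid2-/all_sig2[R Rc RP].
exists [set w | R (w 0).2 (fun n => ((w n).1, (w n.+1).2))].
  move=> w wc /=; apply: Rc => n; have [v wv /= Rv] := wc n.+1.
  rewrite wv//; exists (fun n => ((v n).1, (v n.+1).2)) => // i ilt.
  by rewrite !wv// ltnW.
move=> x /=; split=> [[k /RP[z Rz]]|[z Rz]]; last first.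
  by exists (z 0); apply/RP; exists (fun n => z n.+1).
by exists (fun n => if n is m.+1 then z m else k).
Qed.

(** One witness stores a witness for each of the sets, along the coding of pairs
    of natural numbers. *)
Lemma analytic_bigcap (P : nat -> set (nat -> A)) :
  (forall k, analytic (P k)) -> analytic [set x | forall k, P k x].
Proof.
move=> /(_ _)/cid2-/all_sig2[R Rc RP].
exists [set w | forall k, R k (fun n => ((w n).1, (w (pickle (k, n))).2))].
  move=> w wc k; apply: Rc => n.
  (* A prefix long enough to contain the first n entries of the k-th witness. *)
  pose N := \max_(i < n) (i + pickle (k, nat_of_ord i)).+1.
  have [v wv /= /(_ k) Rv] := wc N.
  exists (fun n => ((v n).1, (v (pickle (k, n))).2)) => // i ilt.
  have iN : (i + pickle (k, i) < N)%N.
    by rewrite /N (bigD1 (Ordinal ilt))//= leq_max leqnn.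
  by rewrite !wv// (leq_ltn_trans _ iN)// ?leq_addl// leq_addr.
move=> x /=; split=> [Px|[z Rz] k]; last first.
  by apply/RP; exists (fun n => z (pickle (k, n))); exact: Rz.
have /(_ _)/cid-/all_sig[z Rz] k : exists z, R k (zip_seq x z) by exact/RP.
exists (fun m => if unpickle m is Some (k, n) then z k n else 0) => k /=.
suff -> : (fun n => (x n, if unpickle (pickle (k, n)) is Some (k0, n0)
  then z k0 n0 else 0)) = zip_seq x (z k) by [].
by apply/funext => n; rewrite pickleK.
Qed.

Lemma analytic_coord (i : nat) (p : A -> Prop) : analytic [set x | p (x i)].
Proof.
exists [set w | p (w i).1] => [w /(_ i.+1)[v wv] /=|x /=]; first by rewrite wv.
by split=> [px|[]//]; exists (fun=> 0).
Qed.

End Analytic.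

(** The sets that are analytic together with their complement form a
    sigma-algebra. *)
Lemma borel_analytic (A : countType) (P : set (nat -> A)) :
  borel_seq P -> analytic P.
Proof.
suff : borel_seq P -> analytic P /\ analytic (~` P).
  by move=> + bP => /(_ bP)[].
have cst (p : Prop) : analytic [set _ : nat -> A | p].
  exact: analytic_coord 0 (fun=> p).
move=> bP; apply: (bP [set Q | analytic Q /\ analytic (~` Q)]).
split; last first.
- move=> _ [i [a ->]]; split; first exact: (analytic_coord i (fun b => b = a)).
  exact: (analytic_coord i (fun b => b <> a)).
- split.
  + by split; [exact: (cst False)|rewrite setC0; exact: (cst True)].
  + by move=> Q [aQ aCQ]; rewrite /= setTD setCK.
  + move=> F aF; split.
      suff -> : \bigcup_k F k = [set x | exists k, F k x].
        by apply: analytic_bigcup => k; have [] := aF k.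
      by apply/predeqP => x; split=> [[k _]|[k]] Fkx; exists k.
    suff -> : ~` (\bigcup_k F k) = [set x | forall k, (~` F k) x].
      by apply: analytic_bigcap => k; have [] := aF k.
    apply/predeqP => x; split=> [nF k Fkx|nF [k _]]; last exact: nF.
    by apply: nF; exists k.
Qed.

Lemma agree_mkseq (A : eqType) n (x y : nat -> A) :
  agree n x y <-> mkseq x n = mkseq y n.
Proof.
split=> [xy|/eq_in_map xy i ilt]; last by apply: xy; rewrite mem_iota.
by apply/eq_in_map => i; rewrite mem_iota => /andP[_]; exact: xy.
Qed.

(** * Lusin separation *)

Definition borel_separated (A : Type) (P Q : set (nat -> A)) :=
  exists2 B, borel_seq B & P `<=` B /\ Q `<=` ~` B.

(** If [B k l] separates [P k] from [Q l], then the union over [k] of the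
    intersections over [l] of the [B k l] separates the unions. *)
Lemma borel_separated_bigcup (A : Type) (K L : countType)
    (P : K -> set (nat -> A)) (Q : L -> set (nat -> A)) :
  (forall k l, borel_separated (P k) (Q l)) ->
  borel_separated [set x | exists k, P k x] [set x | exists l, Q l x].
Proof.
move=> /(_ _)/(_ _)/cid2-/(_ _)/all_sig2-/all_sig2[B Bb BPQ].
exists [set x | exists k, forall l, B k l x].
  apply: (sa_exists (borel_seq_sa A)) => k.
  by apply: (sa_forall (borel_seq_sa A)).
split=> x /=.
- by move=> [k Pkx]; exists k => l; exact: (BPQ k l).1.
- by move=> [l Qlx] [k] /(_ l); exact: (BPQ k l).2.
Qed.

Section LusinSeparation.
Context {A : countType}.

Let proj_ext (R : set (nat -> A * nat)) (s : seq (A * nat)) : set (nat -> A) :=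
  [set x | exists2 z, R (zip_seq x z) & mkseq (zip_seq x z) (size s) = s].

Let proj_ext_rcons R s :
  proj_ext R s = [set x | exists a, proj_ext R (rcons s a) x].
Proof.
apply/predeqP => x /=; split=> [[z Rz zs]|[a [z Rz]]].
  exists (zip_seq x z (size s)), z => //.
  by rewrite size_rcons mkseqS zs.
rewrite size_rcons mkseqS => /rcons_inj[zs _].
by exists z.
Qed.

Let proj_ext_limit R (w : nat -> A * nat) : seq_closed R ->
  (forall n, proj_ext R (mkseq w n) !=set0) ->
  exists z, R (zip_seq (fst \o w) z).
Proof.
move=> Rc Rw; exists (snd \o w).
suff -> : zip_seq (fst \o w) (snd \o w) = w.
  apply: Rc => n; have [x [z Rz]] := Rw n.
  rewrite size_mkseq => zw; exists (zip_seq x z) => //.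
  exact/agree_mkseq/esym.
by apply/funext => n; rewrite /zip_seq/=; case: (w n).
Qed.

(** Were [P] and [Q] not separated by a Borel set, some parts of them, fixed by
    prefixes of length 1 of a point and its witness, would not be separated
    either, and so on for all lengths. In the limit this yields a point of [P] and
    a point of [Q], the defining relations being closed. These two points differ
    at some entry, and then the condition on this entry separates the parts. *)
Theorem lusin_separation (P Q : set (nat -> A)) :
  analytic P -> analytic Q -> (forall x, P x -> ~ Q x) -> borel_separated P Q.
Proof.
move=> [R Rc PR] [S Sc QS] PQ; apply: contrapT => nsep.
pose bad (p : seq (A * nat) * seq (A * nat)) :=
  ~ borel_separated (proj_ext R p.1) (proj_ext S p.2).
have bad0 : bad ([::], [::]).
  apply: contra_not nsep; rewrite /borel_separated => -[B bB [PB QB]].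
  exists B => //; split=> x; first by move=> /PR[z Rz]; apply: PB; exists z.
  by move=> /QS[z Sz]; apply: QB; exists z.
have step (p : {p | bad p}) :
    exists a, bad (rcons (sval p).1 a.1, rcons (sval p).2 a.2).
  case: p => -[s t] /= nst; apply: contrapT => /forallNP h.
  apply: nst; rewrite [X in borel_separated X _]proj_ext_rcons.
  rewrite [X in borel_separated _ X]proj_ext_rcons.
  by apply: borel_separated_bigcup => a b; exact: contrapT (h (a, b)).
move: step => /(_ _)/cid-/all_sig[a badS].
pose st := fix st n := if n is m.+1 then exist bad _ (badS (st m))
  else exist bad _ bad0.
have stE n : sval (st n) =
    (mkseq (fun i => (a (st i)).1) n, mkseq (fun i => (a (st i)).2) n).
  by elim: n => //= n ->; rewrite !mkseqS.
set u := fun i => (a (st i)).1 in stE; set v := fun i => (a (st i)).2 in stE.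
have nstn n : ~ borel_separated (proj_ext R (mkseq u n)) (proj_ext S (mkseq v n)).
  by have := svalP (st n); rewrite stE.
have uP : P (fst \o u).
  apply/PR/proj_ext_limit => // n; apply/set0P/eqP => e0.
  apply: (nstn n); rewrite e0; exists set0; last by split=> // x _ [].
  by case: (borel_seq_sa A).
have vQ : Q (fst \o v).
  apply/QS/proj_ext_limit => // n; apply/set0P/eqP => e0.
  apply: (nstn n); rewrite e0; exists setT; last by split=> // x [].
  exact: (sa_cst (borel_seq_sa A) True).
have [n uvn] : exists n, (u n).1 <> (v n).1.
  apply: contrapT => /forallNP uv; apply: (PQ _ uP).
  suff -> : fst \o u = fst \o v by [].
  by apply/funext => n; exact: contrapT (uv n).
apply: (nstn n.+1); exists [set x | x n = (u n).1].
  by apply: sub_sigma_algebra; exists n, (u n).1.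
split=> x [z _]; rewrite size_mkseq => /agree_mkseq/(_ n (ltnSn n)).
  by move=> <-.
by move=> /= xv xu; apply: uvn; rewrite -xu -xv.
Qed.

End LusinSeparation.

Lemma sa_eq (T : Type) (M : set_system T) (K : countType) (f g : T -> K) :
  sigma_algebra [set: T] M ->
  (forall a, M [set x | f x = a]) -> (forall a, M [set x | g x = a]) ->
  M [set x | f x = g x].
Proof.
move=> saM Mf Mg; have -> : [set x | f x = g x] =
    [set x | exists a, f x = a /\ g x = a].
  apply/predeqP => x /=; split=> [->|[a [-> ->]]//].
  by exists (g x).
by apply: (sa_exists saM) => a; apply: (sa_and saM); [exact: Mf|exact: Mg].
Qed.

Lemma borel_cylinder (A : countType) n (s : seq A) :
  borel_seq [set x : nat -> A | mkseq x n = s].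
Proof.
have [[y ys]|nys] := pselect (exists y : nat -> A, mkseq y n = s).
  have -> : [set x | mkseq x n = s] = [set x | forall i, (i < n)%N -> x i = y i].
    by apply/predeqP => x /=; rewrite -ys; split => /agree_mkseq.
  apply: (sa_forall (borel_seq_sa A)) => i; apply: (sa_imp (borel_seq_sa A)).
  by apply: sub_sigma_algebra; exists i, (y i).
have -> : [set x | mkseq x n = s] = [set x : nat -> A | False].
  by apply/predeqP => x; split=> // xs; apply: nys; exists x.
exact: (sa_cst (borel_seq_sa A)).
Qed.

Lemma closed_borel (A : countType) (R : set (nat -> A)) :
  seq_closed R -> borel_seq R.
Proof.
move=> Rc; have -> : R = [set x | forall n, exists s,
    (exists2 y, R y & mkseq y n = s) /\ mkseq x n = s].
  apply/predeqP => x /=; split=> [Rx n|xR].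
    by exists (mkseq x n); split=> //; exists x.
  apply: Rc => n; have [s [[y Ry <-] xy]] := xR n.
  by exists y => //; apply/agree_mkseq.
apply: (sa_forall (borel_seq_sa A)) => n.
apply: (sa_exists (borel_seq_sa A)) => s.
apply: (sa_and (borel_seq_sa A)); last exact: borel_cylinder.
exact: (sa_cst (borel_seq_sa A)).
Qed.

Lemma analytic_proj (A B : countType) (Q : set (nat -> A * B)) :
  analytic Q -> analytic [set x | exists u, Q (zip_seq x u)].
Proof.
move=> [R Rc QR].
exists [set w | exists v : nat -> B * nat, (forall n, (w n).2 = pickle (v n)) /\
  R (fun n => (((w n).1, (v n).1), (v n).2))].
  move=> w wc /=.
  have : forall n, exists b : B * nat, (w n).2 = pickle b.
    by move=> n; have [y wy [v [yv _]]] := wc n.+1; exists (v n); rewrite wy.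
  move=> /(_ _)/cid-/all_sig[v wv]; exists v; split=> //.
  apply: Rc => n; have [y wy [v' [yv' Rv']]] := wc n.
  exists (fun n => (((y n).1, (v' n).1), (v' n).2)) => // i ilt.
  have -> : v i = v' i by apply: (pcan_inj pickleK); rewrite -wv -yv' wy.
  by rewrite wy.
move=> x /=; split=> [[u /QR[z Rz]]|[z [v [zv Rv]]]].
  by exists (fun n => pickle (u n, z n)), (fun n => (u n, z n)).
by exists (fst \o v); apply/QR; exists (snd \o v).
Qed.

(** * Configurations in the sections of a closed relation *)

Definition borel_fun (f : (nat -> bool) -> nat -> bool) :=
  forall i b, borel_seq [set x | f x i = b].

(** A point over [x] is a sequence of nodes, that is a point [y] of the section at
    [x] zipped with the witness that [y] lies there. *)
Definition node := (bool * nat)%type.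

(** One sequence of nodes holds countably many of them. *)
Definition slot (v : nat -> bool * node) (k : nat) : nat -> node :=
  fun n => (v (pickle (k, n))).2.

Section Configurations.

Variable K : (nat -> bool) -> (nat -> node) -> Prop.
Hypothesis K_closed : seq_closed
  [set v : nat -> bool * node | K (fst \o v) (snd \o v)].

Implicit Types (q : seq bool * seq (seq node)) (x : nat -> bool)
  (g : nat -> nat -> node) (F : nat -> (nat -> bool) -> nat -> bool).

(** An approximation [q] consists of a prefix [q.1] and of finitely many prefixes
    [q.2] of the same length. A configuration for [q] is a point [x] together
    with one point over [x] for each of them. *)
Definition config q x g :=
  mkseq x (size q.1) = q.1 /\
  forall k, (k < size q.2)%N ->
    mkseq (g k) (size q.1) = nth [::] q.2 k /\ K x (g k).

Definition avoids F m x g :=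
  forall k, (k < m)%N -> forall n, fst \o g k <> F n x.

(** The largeness notion driving the construction of a perfect set: no countable
    family of Borel functions meets all the configurations for [q]. *)
Definition good q := forall F, (forall n, borel_fun (F n)) ->
  exists x g, config q x g /\ avoids F (size q.2) x g.

(** Goodness is a property of largeness for a sigma-ideal: the countably many
    families spoiling the approximations in [Q] are merged into one. *)
Lemma bad_family (Q : set (seq bool * seq (seq node))) :
  (forall q, Q q -> ~ good q) ->
  exists2 F, (forall n, borel_fun (F n)) &
    forall q x g, Q q -> config q x g -> ~ avoids F (size q.2) x g.
Proof.
move=> Qbad.
have Hq q : exists F, (forall n, borel_fun (F n)) /\
    forall x g, Q q -> config q x g -> ~ avoids F (size q.2) x g.
  have [Qq|nQq] := pselect (Q q); last first.
    exists (fun _ _ _ => false); split=> // n i b.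
    exact: (sa_cst (borel_seq_sa bool)).
  have := Qbad q Qq => /existsNP[F /not_implyP[bF nF]].
  by exists F; split=> // x g _ cg aF; apply: nF; exists x, g.
move: Hq => /(_ _)/cid-/all_sig[F HF].
exists (fun n => if unpickle n is Some (q, n') then F q n' else
  fun _ _ => false) => [n|q x g Qq cg aF].
  case: unpickle => [[q n']|]; first exact: (HF q).1.
  by move=> i b; exact: (sa_cst (borel_seq_sa bool)).
apply: ((HF q).2 x g Qq cg) => k km n.
by have := aF k km (pickle (q, n)); rewrite pickleK.
Qed.

(** The configurations with a prescribed bit, [g] being stored in the slots of a
    single sequence so that quantifying over [g] is a projection. *)
Lemma borel_config q F m i n b : (forall n, borel_fun (F n)) ->
  borel_seq [set v | [/\ config q (fst \o v) (slot v),
    avoids F m (fst \o v) (slot v) & (slot v i n).1 = b]].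
Proof.
move=> bF; set saM := borel_seq_sa (bool * node).
have fstB U : borel_seq U -> borel_seq [set v : nat -> bool * node | U (fst \o v)].
  apply: (borel_seq_preim saM) => j a.
  exact: (borel_coord j (fun p : bool * node => p.1 = a)).
have slotB k U : borel_seq U -> borel_seq [set v | U (slot v k)].
  apply: (borel_seq_preim saM) => j a.
  exact: (borel_coord _ (fun p : bool * node => p.2 = a)).
have KB k : borel_seq [set v | K (fst \o v) (slot v k)].
  apply: (@borel_seq_preim _ _ _ (fun v => zip_seq (fst \o v) (slot v k))
    saM _ _ (closed_borel K_closed)) => j [a c].
  have -> : [set t | zip_seq (fst \o t) (slot t k) j = (a, c)] =
      [set t | (t j).1 = a /\ slot t k j = c].
    by apply/predeqP => t /=; rewrite /zip_seq; split=> [[-> ->]|[/= -> ->]].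
  apply: (sa_and saM); first exact: (borel_coord j (fun p : bool * node => p.1 = a)).
  exact: (borel_coord _ (fun p : bool * node => p.2 = c)).
have -> : [set v | [/\ config q (fst \o v) (slot v),
    avoids F m (fst \o v) (slot v) & (slot v i n).1 = b]] =
  [set v | config q (fst \o v) (slot v) /\
     (avoids F m (fst \o v) (slot v) /\ (slot v i n).1 = b)].
  by apply/predeqP => v /=; split=> [[? ? ?]|[? [? ?]]].
apply: (sa_and saM); last apply: (sa_and saM).
- apply: (sa_and saM); first exact: (fstB _ (borel_cylinder _ _)).
  apply: (sa_forall saM) => k; apply: (sa_imp saM); apply: (sa_and saM).
    exact: (slotB _ _ (borel_cylinder _ _)).
  exact: KB.
- rewrite /avoids; apply: (sa_forall saM) => k; apply: (sa_imp saM).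
  apply: (sa_forall saM) => l; apply: (sa_not saM).
  rewrite [X in borel_seq X](_ : _ =
      [set v | forall j, (slot v k j).1 = F l (fst \o v) j]); last first.
    by apply/predeqP => v /=; split=> [<-//|H]; apply/funext.
  apply: (sa_forall saM) => j; apply: sa_eq => // a.
    exact: (borel_coord _ (fun p : bool * node => p.2.1 = a)).
  exact: (fstB _ (bF l j a)).
- exact: (borel_coord _ (fun p : bool * node => p.2.1 = b)).
Qed.

Lemma analytic_config q F m i n b : (forall n, borel_fun (F n)) ->
  analytic [set x | exists g, [/\ config q x g, avoids F m x g & (g i n).1 = b]].
Proof.
move=> bF; have -> : [set x | exists g, [/\ config q x g, avoids F m x g &
    (g i n).1 = b]] = [set x | exists u, [set v | [/\ config q (fst \o v) (slot v),
    avoids F m (fst \o v) (slot v) & (slot v i n).1 = b]] (zip_seq x u)].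
  apply/predeqP => x /=; split=> [[g gP]|[u uP]]; last first.
    by exists (slot (zip_seq x u)).
  exists (fun l => if unpickle l is Some (k, n') then g k n' else (false, 0)).
  set u := (fun l => _).
  suff -> : slot (zip_seq x u) = g by [].
  by apply/funext => k; apply/funext => j; rewrite /slot /u /= pickleK.
by apply: analytic_proj; apply: borel_analytic; exact: borel_config.
Qed.

(** One node of a good approximation can be split in two, the copy being appended
    at the end. Otherwise a single family [F] meets the configurations of all the
    candidates for the split approximation. Then two configurations for [q] over
    the same [x] that avoid [F] agree on the [i]-th value, or else they could be
    glued to a configuration for such a candidate. So this value is a function of
    [x], and it is Borel because the sets of [x] where its [n]-th bit is true,
    respectively false, are disjoint and analytic. Adding this function to [F]
    leaves no configuration for [q] at all. *)
Lemma split_node q i : good q -> (i < size q.2)%N ->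
  exists q', [/\ good q', (size q.1 < size q'.1)%N /\ take (size q.1) q'.1 = q.1,
    size q'.2 = (size q.2).+1,
    (forall k, (k < size q.2)%N ->
       take (size q.1) (nth [::] q'.2 k) = nth [::] q.2 k) &
    take (size q.1) (nth [::] q'.2 (size q.2)) = nth [::] q.2 i /\
    map fst (nth [::] q'.2 i) <> map fst (nth [::] q'.2 (size q.2))].
Proof.
move=> gq im; apply: contrapT => /forallNP nq.
have [|F bF HF] := @bad_family [set q' |
    [/\ (size q.1 < size q'.1)%N /\ take (size q.1) q'.1 = q.1,
    size q'.2 = (size q.2).+1,
    (forall k, (k < size q.2)%N ->
       take (size q.1) (nth [::] q'.2 k) = nth [::] q.2 k) &
    take (size q.1) (nth [::] q'.2 (size q.2)) = nth [::] q.2 i /\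
    map fst (nth [::] q'.2 i) <> map fst (nth [::] q'.2 (size q.2))]].
  by move=> q' [? ? ? ?] gq'; apply: (nq q').
set m := size q.2 in im *.
pose A b n := [set x | exists g, [/\ config q x g, avoids F m x g & (g i n).1 = b]].
have sepA n : borel_separated (A true n) (A false n).
  apply: lusin_separation; [exact: analytic_config|exact: analytic_config|].
  move=> x [g [cg ag gin]] [g' [cg' ag' gin']].
  (* The configuration g, with the i-th point of g' as an additional point. *)
  pose h k := if k == m then g' i else g k.
  pose N := (size q.1 + n).+1.
  have szN : (size q.1 < N)%N by rewrite ltnS leq_addr.
  have tk (T : Type) (f : nat -> T) : take (size q.1) (mkseq f N) = mkseq f (size q.1).
    by rewrite /mkseq -map_take take_iota (minn_idPl (ltnW szN)).
  have nthh k : (k < m.+1)%N ->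
      nth [::] (mkseq (fun k => mkseq (h k) N) m.+1) k = mkseq (h k) N.
    exact: nth_mkseq.
  have hlt k : (k < m)%N -> h k = g k by move=> km; rewrite /h ltn_eqF.
  have hm : h m = g' i by rewrite /h eqxx.
  apply: (HF (mkseq x N, mkseq (fun k => mkseq (h k) N) m.+1) x h); rewrite ?size_mkseq.
  - split; rewrite -?[_.1]/(mkseq x N) -?[_.2]/(mkseq _ _).
    + by rewrite size_mkseq tk; case: cg.
    + by rewrite size_mkseq.
    + move=> k km; rewrite nthh ?ltnS 1?ltnW// tk hlt//.
      by case: cg => _ /(_ k km)[].
    + rewrite nthh// tk hm; split; first by case: cg' => _ /(_ i im)[].
      rewrite nthh ?ltnS 1?ltnW// hlt// => e.
      have := congr1 (nth false ^~ n) e.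
      rewrite !(nth_map (false, 0)) ?size_mkseq ?ltnS ?leq_addl//.
      by rewrite !nth_mkseq ?ltnS ?leq_addl// gin gin'.
  - split; rewrite -?[_.1]/(mkseq x N) -?[_.2]/(mkseq _ m.+1) !size_mkseq//.
    move=> k km; split; first by rewrite nthh.
    move: km; rewrite ltnS leq_eqVlt => /orP[/eqP->|km].
      by rewrite hm; case: cg' => _ /(_ i im)[].
    by rewrite hlt//; case: cg => _ /(_ k km)[].
  - move=> k; rewrite ltnS leq_eqVlt => /orP[/eqP->|km] l.
      by rewrite hm; exact: ag'.
    by rewrite hlt//; exact: ag.
move: sepA => /(_ _)/cid2-/all_sig2[B bB AB].
pose f x n : bool := `[< B n x >].
have [|x [g [cg ag]]] := gq (fun n => if n is n'.+1 then F n' else f).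
  move=> [|n]; last exact: bF.
  move=> n [].
    suff -> : [set x | f x n = true] = B n by exact: bB.
    by apply/predeqP => x /=; rewrite /f; split=> [/asboolP|/asboolP].
  suff -> : [set x | f x n = false] = ~` B n.
    exact: (sa_not (borel_seq_sa bool)).
  by apply/predeqP => x /=; rewrite /f; split=> [/asboolPn|/asboolPn/negbTE].
apply: (ag i im 0); apply/funext => n /=.
have aF : avoids F m x g by move=> k km l; exact: (ag k km l.+1).
have [AT AF] := AB n.
case gin: (g i n).1.
  by symmetry; apply/asboolP/AT; exists g.
by symmetry; apply/asboolPn/AF; exists g.
Qed.

End Configurations.

(** * Lusin-Novikov uniformization *)

Lemma chain_limit (A : Type) (a0 : A) (c : nat -> seq A) (d : nat -> nat) :
  (forall t, size (c t) = d t) -> (forall t, (d t < d t.+1)%N) ->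
  (forall t, take (d t) (c t.+1) = c t) ->
  exists w : nat -> A, forall t, mkseq w (d t) = c t.
Proof.
move=> cd dlt ctake.
have dle s t : (s <= t)%N -> (d s <= d t)%N.
  by elim: t => [|t IH]; [rewrite leqn0 => /eqP->|
    rewrite leq_eqVlt => /orP[/eqP->//|/IH/leq_trans]; apply; exact: ltnW].
have tle t : (t <= d t)%N by elim: t => // t IH; exact: leq_ltn_trans IH (dlt t).
have take_le s t : (s <= t)%N -> take (d s) (c t) = c s.
  elim: t => [|t IH]; rewrite leq_eqVlt.
    by rewrite ltn0 orbF => /eqP->; rewrite -cd take_size.
  move=> /orP[/eqP->|st]; first by rewrite -cd take_size.
  by rewrite -IH// -[in RHS]ctake take_takel// dle.
exists (fun i => nth a0 (c i.+1) i) => t.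
apply: (@eq_from_nth _ a0); rewrite size_mkseq // => i it.
rewrite nth_mkseq//; have [ti|ti] := leqP t i.+1.
  by rewrite -(take_le _ _ ti) nth_take.
by rewrite -(take_le _ _ (ltnW ti)) nth_take.
Qed.

Section PerfectSet.

Variable K : (nat -> bool) -> (nat -> node) -> Prop.
Hypothesis K_closed : seq_closed
  [set v : nat -> bool * node | K (fst \o v) (snd \o v)].

Implicit Types (q : seq bool * seq (seq node)) (x : nat -> bool).

(** Every node [k] of [q] has been split into the nodes [k] and [size q.2 + k] of
    [q']. *)
Definition splitting q q' :=
  [/\ (size q.1 < size q'.1)%N /\ take (size q.1) q'.1 = q.1,
    size q'.2 = (size q.2).*2,
    (forall k, (k < size q.2)%N ->
      take (size q.1) (nth [::] q'.2 k) = nth [::] q.2 k),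
    (forall k, (k < size q.2)%N ->
      take (size q.1) (nth [::] q'.2 (size q.2 + k)) = nth [::] q.2 k) &
    (forall k, (k < size q.2)%N ->
      map fst (nth [::] q'.2 k) <> map fst (nth [::] q'.2 (size q.2 + k)))].

Lemma split_all q : good K q -> (0 < size q.2)%N ->
  exists2 q', good K q' & splitting q q'.
Proof.
move=> gq q0; pose n := size q.1; pose m := size q.2.
(* q' has only split the nodes below j; the length increases if there are any. *)
have partial j : (j <= m)%N -> exists q', [/\ good K q',
    (n + (0 < j) <= size q'.1)%N /\ take n q'.1 = q.1,
    size q'.2 = m + j,
    (forall k, (k < m)%N -> take n (nth [::] q'.2 k) = nth [::] q.2 k) &
    (forall k, (k < j)%N ->
      take n (nth [::] q'.2 (m + k)) = nth [::] q.2 k /\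
      map fst (nth [::] q'.2 k) <> map fst (nth [::] q'.2 (m + k)))].
  elim: j => [_|j IH jm].
    exists q; rewrite !addn0 take_size; split=> // k km.
    apply: take_oversize; have [|x [g [[_ cg] _]]] := gq (fun _ _ _ => false).
      by move=> _ i b; exact: (sa_cst (borel_seq_sa bool)).
    by have [<- _] := cg k km; rewrite size_mkseq.
  have [q1 [gq1 [nq1 tq1] sz1 old1 new1]] := IH (ltnW jm).
  have nn1 : (n <= size q1.1)%N by rewrite (leq_trans _ nq1)// leq_addr.
  have [|q2 [gq2 [nq2 tq2] sz2 old2 [new2 dif2]]] := split_node K_closed (i := j) gq1.
    by rewrite sz1 (leq_trans jm)// leq_addr.
  have tt (T : Type) (s : seq T) : take n (take (size q1.1) s) = take n s.
    by rewrite take_takel.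
  exists q2; split=> //.
  - by rewrite addn1 -tt tq2 tq1; split=> //; exact: leq_ltn_trans nn1 nq2.
  - by rewrite sz2 sz1 addnS.
  - by move=> k km; rewrite -tt old2 ?old1// sz1 (leq_trans km)// leq_addr.
  - move=> k; rewrite ltnS leq_eqVlt => /orP[/eqP->|kj].
      rewrite -sz1; split; last exact: dif2.
      by rewrite -tt new2 old1.
    have mk : (m + k < size q1.2)%N by rewrite sz1 ltn_add2l.
    have [newk difk] := new1 k kj; split; first by rewrite -tt old2.
    have km1 : (k < size q1.2)%N.
      by rewrite sz1 (leq_trans (ltn_trans kj jm))// leq_addr.
    move=> e; apply: difk; rewrite -(old2 _ mk) -(old2 _ km1) !map_take.
    by rewrite e.
have [q' [gq' [nq' tq'] sz old new]] := partial m (leqnn m).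
exists q' => //; split=> //; last 2 first.
- by move=> k /new[].
- by move=> k /new[].
- by move: nq'; rewrite q0 addn1.
- by rewrite sz addnn.
Qed.

(** Splitting forever yields a binary tree of nodes. All its branches lie over
    the limit [x] of the first components, by closedness of [K], and two branches
    take different values from the level on where they part. *)
Lemma good_perfect : good K ([::], [:: [::]]) ->
  exists x (w : (nat -> bool) -> nat -> node),
    (forall a, K x (w a)) /\ injective (fun a => fst \o w a).
Proof.
move=> g0.
pose T := {q | good K q /\ (0 < size q.2)%N}.
have step (q : T) : exists q' : T, splitting (sval q) (sval q').
  case: q => q [gq q0]; have [q' gq' spl] := split_all gq q0.
  suff q'0 : (0 < size q'.2)%N by exists (exist _ q' (conj gq' q'0)).
  by case: spl => _ -> _ _ _; rewrite double_gt0.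
move: step => /(_ _)/cid-/all_sig[next nextP].
pose st t : T := iter t next (exist _ _ (conj g0 (ltn0Sn 0))).
pose d t := size (sval (st t)).1.
have stS t : splitting (sval (st t)) (sval (st t.+1)) by exact: nextP.
have sz2 t : size (sval (st t)).2 = 2 ^ t.
  by elim: t => // t IH; have [_ -> _ _ _] := stS t; rewrite IH -mul2n expnS.
have dlt t : (d t < d t.+1)%N by have [[]] := stS t.
have cfg t : exists x g, config K (sval (st t)) x g.
  have [|x [g [cg _]]] := (svalP (st t)).1 (fun _ _ _ => false).
    by move=> _ i b; exact: (sa_cst (borel_seq_sa bool)).
  by exists x, g.
have tle t : (t <= d t)%N by elim: t => // t IH; exact: leq_ltn_trans IH (dlt t).
have [x xP] : exists x : nat -> bool, forall t, mkseq x (d t) = (sval (st t)).1.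
  by apply: (chain_limit false) => // t; have [[]] := stS t.
(* The node on the branch a at level t: its index has binary digits a. *)
pose idx (a : nat -> bool) := fix idx t := if t is s.+1 then a s * 2 ^ s + idx s else 0.
have idx_lt a t : (idx a t < 2 ^ t)%N.
  elim: t => // t IH /=; rewrite expnS mul2n -addnn -addnS leq_add//.
  by case: (a t); rewrite ?mul1n.
have wP a : exists w : nat -> node, forall t,
    mkseq w (d t) = nth [::] (sval (st t)).2 (idx a t).
  apply: (chain_limit (false, 0)) => // t.
    have [y [g [_ cg]]] := cfg t.
    have [|<- _] := cg (idx a t); first by rewrite sz2.
    by rewrite size_mkseq.
  have [_ _ old new _] := stS t => /=.
  case: (a t); rewrite ?mul1n ?mul0n; last by rewrite add0n old ?sz2.
  by rewrite -sz2 new ?sz2.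
move: wP => /(_ _)/cid-/all_sig[w wP].
exists x, w; split=> [a|a b ab].
  apply: (K_closed (x := zip_seq x (w a))) => n.
  have [y [g [yx yg]]] := cfg n.
  have [|gw Kg] := yg (idx a n); first by rewrite sz2.
  exists (zip_seq y (g (idx a n))) => // i ilt.
  have id : (i < d n)%N := leq_trans ilt (tle n).
  congr pair.
    have /agree_mkseq -> // : mkseq x (d n) = mkseq y (d n) by rewrite xP yx.
  have /agree_mkseq -> // : mkseq (w a) (d n) = mkseq (g (idx a n)) (d n).
  by rewrite wP gw.
apply: contrapT => nab.
have /ex_minnP[t tab tmin] : exists t, a t != b t.
  apply: contrapT => /forallNP h; apply: nab; apply/funext => t.
  by apply/eqP; apply/negPn/negP; exact: h.
have idxE s : (s <= t)%N -> idx a s = idx b s.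
  elim: s => // s IH st_ /=; rewrite IH ?(ltnW st_)//.
  suff -> : a s = b s by [].
  by apply/eqP; apply: contraTT st_ => /tmin; rewrite -leqNgt.
have [_ _ _ _ dif] := stS t.
have := dif (idx a t); rewrite sz2 => /(_ (idx_lt a t)); apply.
have e : map fst (mkseq (w a) (d t.+1)) = map fst (mkseq (w b) (d t.+1)).
  rewrite /mkseq -!map_comp; apply: eq_map => i.
  exact: (congr1 (fun h => h i) ab).
move: e; rewrite !wP /= -(idxE t (leqnn t)).
by case: (a t) (b t) tab => [] [] //= _; rewrite ?mul1n ?mul0n ?add0n.
Qed.

End PerfectSet.

(** Cantor's diagonal argument. *)
Lemma cantor_not_countable (S : set (nat -> bool)) (w : (nat -> bool) -> nat -> bool) :
  injective w -> (forall a, S (w a)) -> ~ countable S.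
Proof.
move=> winj wS /countable_injP[f finj].
pose e a := f (w a).
have einj : injective e.
  by move=> a b eab; apply: winj; apply: finj eab; rewrite inE.
pose a n := ~~ `[< exists b, e b = n /\ b n >].
have : a (e a) = ~~ a (e a).
  rewrite {1}/a; congr negb; apply/asboolP/idP => [[b [/einj <-]]//|aa].
  by exists a.
by case: (a (e a)).
Qed.

(** A Borel relation with countable sections is covered by the graphs of countably
    many Borel functions: the trivial approximation is not good, for lack of a
    perfect set in a section, and a family of functions witnessing this
    meets every point of every section. *)
Theorem lusin_novikov (P : set (nat -> bool * bool)) :
  borel_seq P -> (forall x, countable [set y | P (zip_seq x y)]) ->
  exists2 F : nat -> (nat -> bool) -> (nat -> bool), (forall n, borel_fun (F n)) &
    forall x y, P (zip_seq x y) -> exists n, y = F n x.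
Proof.
move=> /borel_analytic[R Rc PR] Pc.
pose K x (w : nat -> node) := R (zip_seq (zip_seq x (fst \o w)) (snd \o w)).
have Kc : seq_closed [set v : nat -> bool * node | K (fst \o v) (snd \o v)].
  move=> v vc; apply: Rc => n; have [v' vv' Kv'] := vc n.
  exists (zip_seq (zip_seq (fst \o v') (fst \o (snd \o v'))) (snd \o (snd \o v'))) => //.
  by move=> i ilt; rewrite /zip_seq /= vv'.
have /existsNP[F /not_implyP[bF nF]] : ~ good K ([::], [:: [::]]).
  move=> /(good_perfect Kc)[x [w [Kw winj]]].
  apply: (cantor_not_countable winj _ (Pc x)) => a.
  by apply/PR; exists (snd \o w a); exact: Kw.
exists F => // x y /PR[z Rz]; apply: contrapT => /forallNP nFx; apply: nF.
exists x, (fun=> zip_seq y z); split.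
  by split=> // k; rewrite ltnS leqn0 => /eqP->.
by move=> k _ n; exact: nFx.
Qed.

(** * Borel sets of the Cantor space *)

(** Any topology on [nat -> A] lying between the two bounds given by cylinders has
    the same Borel sets. This compares the product topology, a metric topology
    and the sigma-algebra of the coordinates. *)
Lemma borel_from_cylinders (A : countType) (O : set_system (nat -> A)) :
  (forall i a, O [set x | x i = a]) ->
  (forall U, O U -> forall x, U x -> exists n, forall y, agree n x y -> U y) ->
  <<s O >> = @borel_seq A.
Proof.
move=> Ocoord Oagree; apply/seteqP; split; apply: smallest_sub.
- exact: smallest_sigma_algebra.
- move=> U OU.
  have -> : U = [set x | exists s,
      [set y | mkseq y (size s) = s] `<=` U /\ mkseq x (size s) = s].
    apply/predeqP => x /=; split=> [Ux|[s [sU xs]]]; last exact: sU.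
    have [n nU] := Oagree U OU x Ux; exists (mkseq x n).
    by rewrite size_mkseq; split=> // y /= /esym/agree_mkseq; exact: nU.
  apply: (sa_exists (borel_seq_sa A)) => s.
  apply: (sa_and (borel_seq_sa A)); last exact: borel_cylinder.
  exact: (sa_cst (borel_seq_sa A)).
- exact: smallest_sigma_algebra.
- by move=> _ [i [a ->]]; apply: sub_sigma_algebra; exact: Ocoord.
Qed.

Lemma cantor_borelE : <<s @open cantor_space >> = @borel_seq bool.
Proof.
apply: borel_from_cylinders.
- move=> i b; suff -> : [set x : nat -> bool | x i = b] = proj i @^-1` [set b].
    by apply: open_comp; [move=> x _; exact: proj_continuous|exact: discrete_open].
  by apply/predeqP.
- move=> U oU x Ux.
  (* The filter of the cylinders around x converges to x coordinatewise. *)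
  pose F : set_system cantor_space :=
    filter_from [set: nat] (fun n => [set y | agree n x y]).
  have FF : Filter F.
    apply: filter_from_filter; first by exists 0.
    move=> i j _ _; exists (maxn i j) => // y xy.
    by split=> k ki; apply: xy; rewrite leq_max ki ?orbT.
  have Fx : F --> (x : cantor_space).
    apply/cvg_sup => i A; rewrite nbhsE => -[B [[C oC <-] Cx] BA].
    by exists i.+1 => // y xy; apply: BA; rewrite /= /proj -(xy i (ltnSn i)).
  have [n _ nU] : F U by apply: Fx; exact: open_nbhs_nbhs.
  by exists n.
Qed.

Lemma measurable_cantor d (X : measurableType d) (f : X -> borel_cantor) :
  (forall i b, measurable [set x | f x i = b]) -> measurable_fun [set: X] f.
Proof.
move=> mf _ U mU; rewrite setTI.
move: mU; rewrite /measurable/= cantor_borelE => bU.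
exact: (borel_seq_preim (sigma_algebra_measurable X) mf bU).
Qed.

Lemma measurable_cantor_coord d (X : measurableType d) (f : X -> borel_cantor) i b :
  measurable_fun [set: X] f -> measurable [set x | f x i = b].
Proof.
move=> mf; have := mf measurableT [set u | u i = b].
rewrite setTI; apply; rewrite /measurable/= cantor_borelE.
exact: (borel_coord i (fun c : bool => c = b)).
Qed.

(** * Polish spaces inside the Cantor space *)

Section PolishCode.
Local Open Scope ring_scope.
Context {R : realType} {P : metricType R}.
Implicit Types (p q : P) (u : nat -> bool).

Definition radius n : R := n.+1%:R^-1.

Lemma radius_gt0 n : 0 < radius n.
Proof. by rewrite invr_gt0. Qed.

Lemma radius_small (e : R) : 0 < e ->
  exists n, forall m, (n <= m)%N -> radius m < e.
Proof.
move=> /ltr_add_invr[n]; rewrite add0r => ne; exists n => m nm.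
by apply: le_lt_trans ne; rewrite lef_pV2 ?posrE// ler_nat ltnS.
Qed.

Lemma open_mball p (e : R) : open [set q | mdist p q < e].
Proof.
rewrite openE => q /= pq; rewrite /interior.
rewrite -(@metricType_numDomainType.filter_from_mdist_nbhs R P q).
exists (e - mdist p q) => /= [|q' qq']; first by rewrite subr_gt0.
by rewrite /= (le_lt_trans (metric_triangle p q q'))// -ltrBrDl.
Qed.

Lemma open_mballP (U : set P) p : open U -> U p ->
  exists2 e : R, 0 < e & forall q, mdist p q < e -> U q.
Proof.
move=> oU Up; have : nbhs p U by exact: open_nbhs_nbhs.
rewrite -(@metricType_numDomainType.filter_from_mdist_nbhs R P p).
by move=> [e /= e0 eU]; exists e.
Qed.

Lemma countable_dense_seq (p0 : P) (D : set P) : countable D -> dense D ->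
  exists c : nat -> P, forall p e, 0 < e -> exists k, mdist p (c k) < e.
Proof.
move=> /countable_injP[f finj] dD.
pose c n := if pselect (exists q, D q /\ f q = n) is left h
  then projT1 (cid h) else p0.
exists c => p e e0.
have [|q [pq Dq]] := dD _ _ (open_mball p e).
  by exists p; rewrite /= mdistxx.
exists (f q); rewrite /c; case: pselect => [h|]; last by case; exists q.
case: (cid h) => q' [Dq' ff] /=.
by rewrite (finj q' q) ?inE.
Qed.

Variable c : nat -> P.
Hypothesis c_dense : forall p (e : R), 0 < e -> exists k, mdist p (c k) < e.
Hypothesis complete : forall F : set_system P,
  ProperFilter F -> cauchy F -> exists p : P, F --> p.

(** The bits of the code tell to which balls around the dense points [c k] the
    point belongs. *)
Definition polish_code p : nat -> bool := fun i =>
  if unpickle i is Some (n, k) then mdist p (c k) < radius n else false.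

Definition least_near (n k : nat) u :=
  u (pickle (n, k)) /\ forall j, (j < k)%N -> u (pickle (n, j)) = false.

(** The least indices read off from [u] give a sequence converging to [p] at the
    expected speed. *)
Definition codes u p :=
  forall n, exists k, least_near n k u /\ mdist p (c k) <= radius n.

(** By completeness this says that [u] codes some point; it is visibly Borel,
    only the countably many distances between the [c k] being involved. *)
Definition coherent u := forall n m, exists k l,
  [/\ least_near n k u, least_near m l u & mdist (c k) (c l) <= radius n + radius m].

Lemma polish_codeP p : codes (polish_code p) p.
Proof.
move=> n; have [k0 k0P] := c_dense p (radius_gt0 n).
have [k kP kmin] := ex_minnP (ex_intro (fun k => mdist p (c k) < radius n) k0 k0P).
exists k; split; last exact: ltW.
rewrite /least_near /polish_code pickleK; split=> // j jk.
by rewrite pickleK; apply: contraTF jk => /kmin; rewrite leqNgt.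
Qed.

Lemma least_near_inj n k l u : least_near n k u -> least_near n l u -> k = l.
Proof.
move=> [uk ltk] [ul ltl]; case: (ltngtP k l) => // [/ltl|/ltk].
  by rewrite uk.
by rewrite ul.
Qed.

Lemma codes_coherent u p : codes u p -> coherent u.
Proof.
move=> up n m; have [k [nk pk]] := up n; have [l [ml pl]] := up m.
exists k, l; split=> //; rewrite (le_trans (metric_triangle _ p _))//.
by rewrite lerD// metric_sym.
Qed.

Lemma codes_inj u p q : codes u p -> codes u q -> p = q.
Proof.
move=> up uq; apply: (@mdist_positivity R).
apply/eqP; rewrite eq_le mdist_ge0 andbT; apply/ler_addgt0Pl => e e0.
rewrite addr0.
have [n ne] := radius_small (divr_gt0 e0 (ltr0Sn R 1)).
have [k [nk pk]] := up n; have [l [nl ql]] := uq n.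
rewrite (least_near_inj nl nk) in ql.
rewrite (le_trans (metric_triangle _ (c k) _))// (splitr e).
have := ltW (ne n (leqnn n)) => rn.
by rewrite lerD// ?(le_trans pk)// metric_sym (le_trans ql).
Qed.

Lemma coherent_codes u : coherent u -> exists p, codes u p.
Proof.
move=> uc.
have /(_ _)/cid-/all_sig[k kP] n : exists k, least_near n k u.
  by have [k [l [nk _ _]]] := uc n n; exists k.
have kd n m : mdist (c (k n)) (c (k m)) <= radius n + radius m.
  have [i [j [ni mj]]] := uc n m.
  by rewrite (least_near_inj ni (kP n)) (least_near_inj mj (kP m)).
have [|p pP] := complete (F := (c \o k) @ \oo) _.
  apply/cauchy_exP => e e0.
  have [n ne] := radius_small (divr_gt0 e0 (ltr0Sn R 1)).
  exists (c (k n)); exists n => // m /= nm.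
  rewrite ballEmdist /= (le_lt_trans (kd n m))// (splitr e).
  by rewrite ltrD ?ne.
exists p => n; exists (k n); split=> //.
apply/ler_addgt0Pl => e e0.
have e20 := divr_gt0 e0 (ltr0Sn R 1).
have [m1 m1e] := radius_small e20.
have : nbhs p [set q | mdist p q < e / 2].
  by apply: open_nbhs_nbhs; split; [exact: open_mball|rewrite /= mdistxx].
move=> /pP[m2 _ m2e].
pose m := maxn m1 m2.
have := m1e m (leq_maxl _ _) => rm.
have : mdist p (c (k m)) < e / 2 by apply: m2e; exact: leq_maxr.
move=> pm; rewrite (le_trans (metric_triangle _ (c (k m)) _))//.
rewrite (splitr e) -addrA lerD ?(ltW pm)// (le_trans (kd m n))//.
by rewrite lerD2r ltW.
Qed.

Lemma borel_least_near n k : borel_seq (least_near n k).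
Proof.
have saM := borel_seq_sa bool; apply: (sa_and saM).
  exact: (borel_coord _ (fun b : bool => b)).
apply: (sa_forall saM) => j; apply: (sa_imp saM).
exact: (borel_coord _ (fun b : bool => b = false)).
Qed.

Lemma borel_coherent : borel_seq coherent.
Proof.
have saM := borel_seq_sa bool.
apply: (sa_forall saM) => n; apply: (sa_forall saM) => m.
apply: (sa_exists saM) => k; apply: (sa_exists saM) => l.
rewrite [X in borel_seq X](_ : _ = [set u | least_near n k u /\
    (least_near m l u /\ mdist (c k) (c l) <= radius n + radius m)]); last first.
  by apply/predeqP => u; split=> [[? ? ?]|[? [? ?]]].
apply: (sa_and saM); first exact: borel_least_near.
by apply: (sa_and saM); [exact: borel_least_near|exact: (sa_cst saM)].
Qed.

(** The left inverse of the code takes the limit of the coded sequence. Whether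
    the limit lies in an open set [V] is seen at a finite stage: some closed ball
    [q | mdist q (c k) <= radius n] designated by the code is contained in [V]. *)
Lemma polish_decode (p0 : P) : exists D : (nat -> bool) -> P,
  cancel polish_code D /\
  (forall V, <<s @open P >> V -> borel_seq (D @^-1` V)).
Proof.
pose D u := if pselect (exists p, codes u p) is left h then projT1 (cid h) else p0.
have DP u p : codes u p -> D u = p.
  move=> up; rewrite /D; case: pselect => [h|]; last by case; exists p.
  by case: (cid h) => q uq /=; exact: codes_inj uq up.
exists D; split; first by move=> p; apply/DP/polish_codeP.
have saM := borel_seq_sa bool.
apply: (sa_preim saM) => V oV.
have -> : D @^-1` V = [set u | (coherent u /\ exists n k, least_near n k u /\
      forall q, mdist q (c k) <= radius n -> V q) \/ (~ coherent u /\ V p0)].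
  apply/predeqP => u /=.
  have [uc|nuc] := pselect (coherent u); last first.
    have -> : D u = p0.
      by rewrite /D; case: pselect => // h; case: nuc; case: h => p /codes_coherent.
    by split=> [Vp0|[[]|[]]//]; right.
  have [p up] := coherent_codes uc; rewrite (DP u p up).
  split=> [Vp|[[_ [n [k [nk kV]]]]|[]//]]; last first.
    have [l [nl pl]] := up n; apply: kV.
    by rewrite (least_near_inj nk nl).
  left; split=> //; have [e e0 eV] := open_mballP oV Vp.
  have [n ne] := radius_small (divr_gt0 e0 (ltr0Sn R 1)).
  have [k [nk pk]] := up n; exists n, k; split=> // q qk; apply: eV.
  rewrite (le_lt_trans (metric_triangle _ (c k) _))// (splitr e).
  have rn := ne n (leqnn n).
  by rewrite ltrD// ?(le_lt_trans pk)// metric_sym (le_lt_trans qk).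
apply: (sa_or saM); apply: (sa_and saM).
- exact: borel_coherent.
- apply: (sa_exists saM) => n; apply: (sa_exists saM) => k.
  by apply: (sa_and saM); [exact: borel_least_near|exact: (sa_cst saM)].
- by apply: (sa_not saM); exact: borel_coherent.
- exact: (sa_cst saM).
Qed.

End PolishCode.

(** All that is used about a standard Borel space: it is a Borel retract of the
    Cantor space. *)
Lemma standard_borel_retract (R : realType) d (X : measurableType d) :
  standard_borel R X -> exists (e : X -> borel_cantor) (r : borel_cantor -> X),
    [/\ measurable_fun [set: X] e, measurable_fun [set: borel_cantor] r & cancel e r].
Proof.
move=> [P [h [[Pc [D Dc Dd]] hbij mE]]].
have [h' hK h'K] := hbij.
have [c c_dense] := countable_dense_seq (h point) Dc Dd.
have [D' [D'K D'B]] := polish_decode c_dense Pc (h point).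
have saM := sigma_algebra_measurable X.
exists (polish_code c \o h), (h' \o D'); split; last first.
- by move=> x; rewrite /= D'K hK.
- move=> _ U /mE bU; rewrite setTI.
  have -> : (h' \o D') @^-1` U = D' @^-1` (h @` U).
    apply/predeqP => u /=; split=> [Uu|[x Ux <-]]; last by rewrite hK.
    by exists (h' (D' u)).
  by rewrite /measurable/= cantor_borelE; exact: D'B.
- apply: measurable_cantor => i b.
  have mT : measurable [set x | polish_code c (h x) i].
    rewrite /polish_code; case: unpickle => [[n k]|]; last exact: (sa_cst saM).
    apply/mE; apply: sub_sigma_algebra.
    have -> : h @` [set x | (mdist (h x) (c k) < radius n)%R] =
        [set p | (mdist (c k) p < radius n)%R].
      apply/predeqP => p /=; split=> [[x + <-]|]; rewrite metric_sym//.
      by exists (h' p); rewrite h'K.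
    exact: open_mball.
  case: b => //.
  rewrite [X in measurable X](_ : _ = [set x | ~ polish_code c (h x) i]).
    exact: (sa_not saM).
  by apply/predeqP => x /=; split=> [->//|/negP/negbTE].
Qed.

(** * Oracle programs *)

Lemma oracle_eval_inj x c s v w :
  oracle_eval x c s v -> oracle_eval x c s w -> v = w.
Proof.
move: c s v w; fix IH 1; case=> [||i||f gs|f g|f] s v w /=; try by move=> -> ->.
- move=> [vs vsP fv] [ws wsP fw].
  suff vw : vs = ws by move: fv; rewrite vw => /IH/(_ fw).
  elim: gs vs ws vsP wsP {fv fw} => [|g gs IHgs] [|a vs] [|b ws] //=.
  by move=> [ga gvs] [gb gws]; rewrite (IH _ _ _ _ ga gb) (IHgs vs ws).
- elim: (head 0 s) v w => [|n IHn] v w; first exact: IH.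
  by move=> [a /IHn na ga] [b /na ab]; rewrite -ab => /(IH _ _ _ _ ga).
- move=> [fv ltv] [fw ltw]; case: (ltngtP v w) => // [vw|wv].
    by have [u /IH/(_ fv)] := ltw v vw.
  by have [u /IH/(_ fw)] := ltv w wv.
Qed.

Lemma nth_programK : cancel pickle nth_program.
Proof. by move=> c; rewrite /nth_program pickleK. Qed.

Lemma Phi_computed (x y : cantor_space) c :
  (forall n, oracle_eval x c [:: n] (y n)) ->
  Phi_total (pickle c) x /\ Phi (pickle c) x = y.
Proof.
move=> cy; split=> [n|]; first by exists (y n); rewrite nth_programK.
apply/funext => n; rewrite /Phi nth_programK; apply/asboolP/idP => [[v cv]|yn].
  by rewrite (oracle_eval_inj cv (cy n)); case: (y n).
by exists (y n) => //; rewrite yn.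
Qed.

Definition pconst n := iter n (fun c => PComp PSucc [:: c]) PZero.

Lemma pconstP x n s : oracle_eval x (pconst n) s n.
Proof. by elim: n => //= n IH; exists [:: n]. Qed.

Definition pdouble := PRec PZero (PComp PSucc [:: PComp PSucc [:: PProj 1]]).

Lemma pdoubleP x n s : oracle_eval x pdouble (n :: s) n.*2.
Proof.
rewrite /pdouble /=; elim: n => //= n IH; exists n.*2 => //.
by exists [:: n.*2.+1] => //; split=> //; exists [:: n.*2].
Qed.

(** The pairing [2 ^ k * (2 * m + 1)], computed by iterated doubling; its values
    exceed [m], which makes recursion on codes possible. *)
Definition code2 k m := iter k double m.*2.+1.

Lemma code2_inj k m l n : code2 k m = code2 l n -> k = l /\ m = n.
Proof.
elim: k l => [|k IH] [|l] /=.
- by move=> [/double_inj].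
- by move/(congr1 odd); rewrite /= !odd_double.
- by move/(congr1 odd); rewrite /= !odd_double.
- by move/double_inj/IH => [-> ->].
Qed.

Lemma code2_gt k m : (m < code2 k m)%N.
Proof.
elim: k => [|k IH] /=; first by rewrite ltnS -addnn leq_addr.
by rewrite (leq_trans IH)// -addnn leq_addr.
Qed.

Definition pcode2 a b := PComp
  (PRec (PComp PSucc [:: PComp pdouble [:: PProj 0]]) (PComp pdouble [:: PProj 1]))
  [:: a; b].

Lemma pcode2P x a b s k m : oracle_eval x a s k -> oracle_eval x b s m ->
  oracle_eval x (pcode2 a b) s (code2 k m).
Proof.
move=> ak bm; exists [:: k; m]; first by split=> //; split.
rewrite /=; elim: k {ak} => [|k IH].
  exists [:: m.*2] => //; split=> //; exists [:: m] => //.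
  exact: (pdoubleP x m [::]).
exists (code2 k m) => //; exists [:: code2 k m] => //.
exact: (pdoubleP x (code2 k m) [::]).
Qed.

Lemma poracleP x a s k : oracle_eval x a s k ->
  oracle_eval x (PComp POracle [:: a]) s (x k).
Proof. by move=> ak; exists [:: k]. Qed.

(** * Coding a countable family of maps into Turing degrees *)

Section AnswerOracle.
Context {T : Type}.
Variables (e : T -> nat -> bool) (h : nat -> T -> T) (t : nat -> nat -> nat).

(** The oracle attached to [x] answers, besides the questions [e x m], all
    questions about the images of [x] under the [h k], and hence about the images
    under all their compositions. It also contains the graphs of the functions
    [t i], stored so that the values come out by minimization: the entry for [v]
    is 0 exactly if [v] is the value. *)
Inductive answer : T -> nat -> Prop :=
| answer_base x m : e x m -> answer x (code2 0 m)
| answer_table x i m v : v <> t i m -> answer x (code2 1 (code2 i (code2 m v)))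
| answer_step x k m : answer (h k x) m -> answer x (code2 k.+2 m).

Definition answers x : cantor_space := fun n => `[< answer x n >].

Lemma answers_base x m : answers x (code2 0 m) = e x m.
Proof.
apply/asboolP/idP => [|exm]; last exact: answer_base.
move E: (code2 0 m) => n axn; case: axn E => [{}x l exl|{}x i l v _|{}x k l _] E.
- by have [_ ->] := code2_inj E.
- by have [] := code2_inj E.
- by have [] := code2_inj E.
Qed.

Lemma answers_table x i m v :
  answers x (code2 1 (code2 i (code2 m v))) = (v != t i m).
Proof.
apply/asboolP/idP => [|/eqP vt]; last exact: answer_table.
move E: (code2 1 _) => n axn; case: axn E => [{}x l exl|{}x j l w wt|{}x k l _] E.
- by have [] := code2_inj E.
- by have [_ /code2_inj[-> /code2_inj[-> ->]]] := code2_inj E; apply/eqP.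
- by have [] := code2_inj E.
Qed.

Lemma answers_step x k m : answers x (code2 k.+2 m) = answers (h k x) m.
Proof.
apply/asboolP/asboolP => [|a]; last exact: answer_step.
move E: (code2 k.+2 m) => n axn; case: axn E => [{}x l exl|{}x j l w _|{}x j l a] E.
- by have [] := code2_inj E.
- by have [] := code2_inj E.
- by have [[->] ->] := code2_inj E.
Qed.

Lemma answers_inj : injective e -> injective answers.
Proof.
move=> einj x y xy; apply: einj; apply/funext => m.
by rewrite -!answers_base xy.
Qed.

(** The answers for [h k x] are a column of the answers for [x]. *)
Lemma turing_le_answers x k : turing_le (answers (h k x)) (answers x).
Proof.
pose c := PComp POracle [:: pcode2 (pconst k.+2) (PProj 0)].
have [|tot eq] := @Phi_computed (answers x) (answers (h k x)) c.
  move=> n; rewrite -answers_step; apply: poracleP; apply: pcode2P => //.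
  exact: pconstP.
by exists (pickle c).
Qed.

(** Since the oracle contains the graph of [t i], this single reduction works for
    every [x], whatever the complexity of [t i]. *)
Lemma Phi_answers i : exists p, forall x,
  Phi_total p (answers x) /\ Phi p (answers x) = (fun m => answers x (t i m)).
Proof.
pose c := PComp POracle [:: PMin (PComp POracle [:: pcode2 (pconst 1)
  (pcode2 (pconst i) (pcode2 (PProj 1) (PProj 0)))])].
exists (pickle c) => x; apply: Phi_computed => n.
apply: poracleP.
have tabP v : oracle_eval (answers x) (PComp POracle [:: pcode2 (pconst 1)
    (pcode2 (pconst i) (pcode2 (PProj 1) (PProj 0)))]) [:: v; n] (v != t i n).
  rewrite -(answers_table x); apply: poracleP.
  apply: pcode2P; first exact: pconstP.
  apply: pcode2P; first exact: pconstP.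
  exact: pcode2P.
split; first by have := tabP (t i n); rewrite eqxx.
by move=> v vt; exists 0; have := tabP v; rewrite ltn_eqF.
Qed.

End AnswerOracle.

Lemma measurable_answers d (X : measurableType d) (e : X -> borel_cantor)
    (h : nat -> X -> X) (t : nat -> nat -> nat) :
  measurable_fun [set: X] e -> (forall k, measurable_fun [set: X] (h k)) ->
  measurable_fun [set: X] (answers e h t : X -> borel_cantor).
Proof.
move=> me mh; have saM := sigma_algebra_measurable X.
apply: measurable_cantor => n b.
suff mT : measurable [set x | answers e h t x n = true].
  case: b => //; rewrite [X in measurable X](_ : _ =
    [set x | ~ (answers e h t x n = true)]); first exact: (sa_not saM).
  by apply/predeqP => x /=; split=> [->//|/negP/negbTE].
(* Strong induction on the question. *)
have [k nk] := ubnP n; elim: k n nk => // k IH n nk.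
have [[l [m nlm]]|nn] := pselect (exists l m, n = code2 l m); last first.
  rewrite [X in measurable X](_ : _ = set0)//; apply/predeqP => x; split=> //.
  rewrite /= /answers => /asboolP a; apply: nn.
  case: a => [? m _|? i m v _|? l m _]; first by exists 0, m.
    by exists 1, (code2 i (code2 m v)).
  by exists l.+2, m.
have mn : (m < n)%N by rewrite nlm code2_gt.
move: nlm; case: l => [|[|l]] ->.
- rewrite [X in measurable X](_ : _ = [set x | e x m = true]).
    exact: measurable_cantor_coord.
  by apply/predeqP => x /=; rewrite answers_base.
- have [[i [m1 [v mE]]]|nm] := pselect (exists i m1 v, m = code2 i (code2 m1 v)).
    rewrite [X in measurable X](_ : _ = [set _ | v != t i m1]).
      exact: (sa_cst saM).
    by apply/predeqP => x /=; rewrite mE answers_table.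
  rewrite [X in measurable X](_ : _ = set0)//; apply/predeqP => x; split=> // ax.
  have /asboolP : answers e h t x (code2 1 m) := ax.
  move E: (code2 1 m) => c a; apply: nm; case: a E => [y j _|y i j v _|y j p _] E; have [kl ml] := code2_inj E => //.
  by exists i, j, v.
- rewrite [X in measurable X](_ : _ = h l @^-1` [set x | answers e h t x m = true]).
    rewrite -[X in measurable X]setTI; apply: mh => //; apply: IH.
    by rewrite (leq_trans mn).
  by apply/predeqP => x /=; rewrite answers_step.
Qed.

(** * Countable Borel equivalence relations reduce to Turing equivalence *)

(** The relation is transported to the Cantor space along a retraction [r]. In the
    sections of the transported relation only the codes [e y] are kept, which
    makes these sections countable: the fibres of [r] may be uncountable. *)
Theorem countable_borel_graphs (R : realType) d (X : measurableType d)
    (E : X -> X -> Prop) :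
  standard_borel R X -> countable_borel_equivalence E ->
  exists2 g : nat -> X -> X, (forall n, measurable_fun [set: X] (g n)) &
    forall x y, E x y -> exists n, y = g n x.
Proof.
move=> /standard_borel_retract[e [r [me mr eK]]] [_ mE Ec].
pose T := g_sigma_algebraType (@coord_sets (bool * bool)%type).
have mfst : measurable_fun [set: T] (fun v : T => (fst \o v : borel_cantor)).
  apply: measurable_cantor => i b.
  exact: (borel_coord i (fun p : bool * bool => p.1 = b)).
have msnd : measurable_fun [set: T] (fun v : T => (snd \o v : borel_cantor)).
  apply: measurable_cantor => i b.
  exact: (borel_coord i (fun p : bool * bool => p.2 = b)).
have saT := sigma_algebra_measurable T.
pose P : set T := [set v | E (r (fst \o v)) (r (snd \o v)) /\
  forall i, e (r (snd \o v)) i = (snd \o v) i].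
have mP : measurable P.
  apply: (sa_and saT).
    have := measurable_fun_pair (measurableT_comp mr mfst) (measurableT_comp mr msnd).
    by move=> /(_ measurableT _ mE); rewrite setTI.
  apply: (sa_forall saT) => i; apply: (sa_eq saT) => b.
    apply: (@measurable_cantor_coord _ T (fun v => e (r (snd \o v)))).
    exact: (measurableT_comp me (measurableT_comp mr msnd)).
  exact: (@measurable_cantor_coord _ T (fun v => snd \o v)).
have Pc x : countable [set y | P (zip_seq x y)].
  apply: (@sub_countable _ _ _ (e @` E (r x))); last first.
    exact: sub_countable (card_image_le _ _) (Ec _).
  apply: subset_card_le => y [Exy ey]; exists (r y) => //.
  exact/funext.
have [F bF FP] := lusin_novikov mP Pc.
exists (fun n => r \o (F n \o e)) => [n|x y Exy].
  apply: measurableT_comp => //; apply: measurableT_comp => //.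
  apply: measurable_cantor => i b; rewrite /measurable/= cantor_borelE.
  exact: bF.
have [|n en] := FP (e x) (e y).
  rewrite /P /= (_ : fst \o _ = e x) // (_ : snd \o _ = e y)// !eK.
  by split.
by exists n; rewrite /= -en eK.
Qed.

(** The maps [h k] enumerate the functions covering [E] and all the coordinates of
    the [f i]. The former make the answers for equivalent points Turing
    equivalent; thanks to the latter, the answers for the points [f i x j], for all
    [j] together, are computed from those for [x] by one reduction [p]. Hence an
    infinite range of [f i x] inside a class of the pulled back relation [F n]
    would give an infinite range of [turing_seq pairing p] inside a class of
    [F n]. *)
Theorem turing_hyper_borel_finite (R : realType) (pairing : nat -> nat -> nat) :
  computable_bijection pairing -> hyper_recursively_finite pairing ->
  forall (d : measure_display) (X : measurableType d) (E : X -> X -> Prop),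
    standard_borel R X -> countable_borel_equivalence E -> hyper_borel_finite E.
Proof.
move=> [[unpair pK unpairK] _] [F [Fc FT Finc Ffin TF]] d X E sX cE f mf.
have [g mg gE] := countable_borel_graphs sX cE.
have [e [r [me _ eK]]] := standard_borel_retract sX.
have [eE mE Ec] := cE.
pose h (k : nat) : X -> X := match unpickle k with
  | Some (inl n) => g n
  | Some (inr (i, j)) => fun x => f i x j
  | None => id
  end.
(* If m = pairing j n, this is the question n about f i x j. *)
pose t (i m : nat) :=
  code2 (pickle (inr ((i, (unpair m).1)) : nat + nat * nat)).+2 (unpair m).2.
pose phi : X -> borel_cantor := answers e h t.
have hg n : h (pickle (inl n : nat + nat * nat)) = g n by rewrite /h pickleK.
have hf i j : h (pickle (inr (i, j) : nat + nat * nat)) = f i ^~ j.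
  by rewrite /h pickleK.
have mh k : measurable_fun [set: X] (h k).
  rewrite /h; case: unpickle => [[n|[i j]]|] //.
  move=> _ U mU; rewrite setTI.
  have := mf i measurableT [set u | U (u j)]; rewrite setTI; apply.
  apply: sub_sigma_algebra; exists j => //; exists U => //.
  by rewrite setTI.
have mphi : measurable_fun [set: X] phi by exact: measurable_answers.
have phi_inj : injective phi by apply: answers_inj; exact: can_inj eK.
have phi_le x y : E x y -> turing_le (phi y) (phi x).
  move=> /gE[n ->]; have := turing_le_answers e h t x (pickle (inl n : nat + nat * nat)).
  by rewrite hg.
have phiE x y : E x y -> turing_equiv (phi x) (phi y).
  by move=> Exy; split; apply: phi_le => //; exact: (RelationClasses.Equivalence_Symmetric _ _ Exy).
exists (fun n x y => E x y /\ F n (phi x) (phi y)); split.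
- move=> n; have [Fe mF _] := Fc n; split.
  + split.
    * by move=> x; split; exact: RelationClasses.Equivalence_Reflexive.
    * move=> x y [Exy Fxy].
      by split; exact: RelationClasses.Equivalence_Symmetric.
    * move=> x y z [Exy Fxy] [Eyz Fyz].
      by split; apply: RelationClasses.Equivalence_Transitive; eassumption.
  + have saXX := sigma_algebra_measurable (X * X)%type.
    apply: (sa_and saXX) => //.
    have m2 : measurable_fun [set: X * X] (fun p : X * X => (phi p.1, phi p.2)).
      apply: measurable_fun_pair; apply: (measurableT_comp mphi).
        exact: measurable_fst.
      exact: measurable_snd.
    by have := m2 measurableT _ mF; rewrite setTI.
  + move=> x; apply: sub_countable (Ec x).
    by apply: subset_card_le => y [].
- by move=> n x y [].
- by move=> n x y [Exy /Finc Fxy].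
- move=> n [i [x [inf sub]]]; apply: (Ffin n).
  have [p pP] := Phi_answers e h t i.
  have seqE j : turing_seq pairing p (phi x) j = phi (f i x j).
    have [tot eq] := pP x.
    rewrite /turing_seq asboolT //; apply/funext => m; rewrite eq.
    have up : unpair (pairing j m) = (j, m) := pK (j, m).
    rewrite -[LHS]/(answers e h t x (t i (pairing j m))) /t up.
    by rewrite answers_step hf.
  have rangeE : range (turing_seq pairing p (phi x)) = phi @` range (f i x).
    apply/seteqP; split=> [_ [j _ <-]|_ [_ [j _ <-] <-]].
      by rewrite seqE; exists (f i x j) => //; exists j.
    by exists j => //; rewrite seqE.
  exists p, (phi x); split; last first.
    by rewrite rangeE => _ [y /sub[_ Fxy] <-].
  rewrite rangeE; apply: contra_not inf => fin.
  apply: sub_finite_set (finite_preimage (f := phi) _ fin).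
    by move=> y fy; exists y.
  by move=> y z _ _; exact: phi_inj.
- move=> x y; split=> [Exy|[n []]//].
  by have /TF[n Fn] := phiE x y Exy; exists n.
Qed.

(** * Turing equivalence is a countable Borel equivalence relation *)

Lemma Phi_eval i (x : cantor_space) n v :
  oracle_eval x (nth_program i) [:: n] v -> Phi i x n = (v != 0).
Proof.
move=> ev; apply/asboolP/idP => [[w /(oracle_eval_inj ev) <-]//|v0].
by exists v.
Qed.

(** A form of reducibility with quantifiers over natural numbers only, from which
    Borelness is immediate. *)
Lemma turing_leP (y x : cantor_space) : turing_le y x <->
  exists i, forall n, exists v, oracle_eval x (nth_program i) [:: n] v /\
    y n = (v != 0).
Proof.
split=> [[i tot yE]|[i iP]]; exists i.
- move=> n; have [v ev] := tot n; exists v; split=> //.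
  by rewrite -yE; exact: Phi_eval.
- by move=> n; have [v [ev _]] := iP n; exists v.
- by apply/funext => n; have [v [ev ->]] := iP n; exact: Phi_eval.
Qed.

(** Turns any nonzero output into 1, the value of an oracle at its members. *)
Definition psign := PRec PZero (pconst 1).

Lemma psignP x w s : oracle_eval x psign (w :: s) (w != 0).
Proof.
rewrite /psign /=; elim: w => //= w IH; exists (w != 0) => //.
by exists [:: 0].
Qed.

(** Replaces the questions to the oracle by runs of [d], composing reductions. *)
Fixpoint psubst (d c : program) : program :=
  match c with
  | PZero => PZero
  | PSucc => PSucc
  | PProj i => PProj i
  | POracle => PComp psign [:: PComp d [:: PProj 0]]
  | PComp f gs => PComp (psubst d f) (map (psubst d) gs)
  | PRec f g => PRec (psubst d f) (psubst d g)
  | PMin f => PMin (psubst d f)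
  end.

Lemma psubstP (x y : cantor_space) d :
  (forall n, exists v, oracle_eval x d [:: n] v /\ y n = (v != 0)) ->
  forall c s v, oracle_eval y c s v -> oracle_eval x (psubst d c) s v.
Proof.
move=> dP; fix IH 1; case=> [||i||f gs|f g|f] s v //.
- move=> /= ->; have [w [dw ->]] := dP (head 0 s).
  exists [:: w]; last exact: psignP.
  by split=> //; exists [:: head 0 s]; rewrite // -nth0; split.
- move=> /= [vs vsP fv]; exists vs; last exact: IH.
  elim: gs vs vsP {fv} => [|g gs IHgs] [|w vs] //= [gw gvs].
  by split; [exact: IH|exact: IHgs].
- move=> /=; elim: (head 0 s) v => [|n IHn] v; first exact: IH.
  by move=> [u nu gv]; exists u; [exact: IHn|exact: IH].
- move=> /= [fv ltv]; split; first exact: IH.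
  by move=> m /ltv[u fu]; exists u; exact: IH.
Qed.

Lemma turing_le_refl x : turing_le x x.
Proof.
have [tot eq] := @Phi_computed x x POracle (fun=> erefl).
by exists (pickle POracle).
Qed.

Lemma turing_le_trans y x z : turing_le z y -> turing_le y x -> turing_le z x.
Proof.
move=> /turing_leP[i iP] /turing_leP[j jP]; apply/turing_leP.
exists (pickle (psubst (nth_program j) (nth_program i))) => n.
rewrite nth_programK.
by have [v [ev zn]] := iP n; exists v; split=> //; exact: psubstP ev.
Qed.

Lemma borel_oracle_eval c s v :
  borel_seq [set x : nat -> bool | oracle_eval x c s v].
Proof.
have saM := borel_seq_sa bool.
move: c s v; fix IH 1; case=> [||i||f gs|f g|f] s v /=.
- exact: (sa_cst saM).
- exact: (sa_cst saM).
- exact: (sa_cst saM).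
- exact: (borel_coord _ (fun b : bool => v = b)).
- rewrite [X in borel_seq X](_ : _ = [set x | exists vs, (fix evals
      (hs : seq program) (ws : seq nat) : Prop := match hs, ws with
       | [::], [::] => True
       | h :: hs', w :: ws' => oracle_eval x h s w /\ evals hs' ws'
       | _, _ => False
       end) gs vs /\ oracle_eval x f vs v]); last first.
    by apply/predeqP => x /=; split=> [[vs]|[vs []]]; exists vs.
  apply: (sa_exists saM) => vs; apply: (sa_and saM); last exact: IH.
  elim: gs vs => [|g gs IHgs] [|w vs]; try exact: (sa_cst saM).
  by apply: (sa_and saM); [exact: IH|exact: IHgs].
- elim: (head 0 s) v => [|n IHn] v; first exact: IH.
  rewrite [X in borel_seq X](_ : _ = [set x | exists u, (fix rec (n w : nat) : Prop :=
         if n is m.+1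
         then exists2 u, rec m u & oracle_eval x g [:: m, u & behead s] w
         else oracle_eval x f (behead s) w) n u /\
       oracle_eval x g [:: n, u & behead s] v]); last first.
    by apply/predeqP => x /=; split=> [[u]|[u []]]; exists u.
  by apply: (sa_exists saM) => u; apply: (sa_and saM); [exact: IHn|exact: IH].
- apply: (sa_and saM); first exact: IH.
  apply: (sa_forall saM) => m; apply: (sa_imp saM).
  by apply: (sa_exists saM) => u; exact: IH.
Qed.

Lemma measurable_oracle_eval c s v :
  measurable [set x : borel_cantor | oracle_eval x c s v].
Proof. by rewrite /measurable/= cantor_borelE; exact: borel_oracle_eval. Qed.

Lemma measurable_turing_le d (X : measurableType d) (f g : X -> borel_cantor) :
  measurable_fun [set: X] f -> measurable_fun [set: X] g ->
  measurable [set p | turing_le (f p) (g p)].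
Proof.
move=> mf mg; have saM := sigma_algebra_measurable X.
rewrite [X in measurable X](_ : _ = [set p | exists i, forall n, exists v,
    oracle_eval (g p) (nth_program i) [:: n] v /\ f p n = (v != 0)]); last first.
  by apply/predeqP => p; exact: turing_leP.
apply: (sa_exists saM) => i; apply: (sa_forall saM) => n.
apply: (sa_exists saM) => v; apply: (sa_and saM).
  rewrite -[X in measurable X]setTI.
  exact: (mg measurableT _ (measurable_oracle_eval _ _ _)).
exact: measurable_cantor_coord.
Qed.

Lemma turing_countable_borel : countable_borel_equivalence turing_equiv.
Proof.
split.
- split.
  + by move=> x; split; exact: turing_le_refl.
  + by move=> x y [].
  + by move=> x y z [xy yx] [yz zy]; split; apply: turing_le_trans; eassumption.
- apply: (sa_and (sigma_algebra_measurable _)).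
    by apply: measurable_turing_le; [exact: measurable_fst|exact: measurable_snd].
  by apply: measurable_turing_le; [exact: measurable_snd|exact: measurable_fst].
- move=> x; apply: (@sub_countable _ _ _ (range (fun i => Phi i x))).
    by apply: subset_card_le => y [_ [i _ <-]]; exists i.
  by apply: sub_countable (card_image_le _ _) _; exact: countableP.
Qed.

Lemma borel_turing_seq pairing i : borel_seq_fun (turing_seq pairing i).
Proof.
have saM := sigma_algebra_measurable borel_cantor.
suff mj j : measurable_fun [set: borel_cantor] (fun x => turing_seq pairing i x j).
  move=> _ U mU; rewrite setTI.
  apply: (sa_preim saM _ mU) => _ [j _ [B mB <-]].
  rewrite setTI; have := mj j measurableT _ mB; rewrite setTI; exact.
apply: measurable_cantor => n b.
rewrite [X in measurable X](_ : _ = [set x : borel_cantor |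
  (Phi_total i x /\ exists v, oracle_eval x (nth_program i) [:: pairing j n] v /\
    (v != 0) = b) \/ (~ Phi_total i x /\ x n = b)]); last first.
  apply/predeqP => x /=; rewrite /turing_seq; case: asboolP => [tot|ntot].
    split=> [<-|[[_ [v [ev <-]]]|[]//]]; last exact: Phi_eval.
    left; split=> //; have [v ev] := tot (pairing j n); exists v.
    by rewrite (Phi_eval ev).
  by split=> [xn|[[]|[]]//]; right.
have mtot : measurable [set x : borel_cantor | Phi_total i x].
  apply: (sa_forall saM) => m; apply: (sa_exists saM) => v.
  exact: measurable_oracle_eval.
apply: (sa_or saM); apply: (sa_and saM) => //.
- apply: (sa_exists saM) => v; apply: (sa_and saM); last exact: (sa_cst saM).
  exact: measurable_oracle_eval.
- exact: (sa_not saM).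
- by apply: (@measurable_cantor_coord _ borel_cantor id); exact: measurable_id.
Qed.

(** * The Cantor space is standard Borel *)

Section CantorMetric.
Local Open Scope ring_scope.
Context {R : realType}.
Implicit Types x y z : nat -> bool.

(** [1 / (n + 1)], where [n] is the first place at which [x] and [y] differ. *)
Definition cantor_dist x y : R :=
  if pselect (exists n, x n != y n) is left h then radius (ex_minn h) else 0.

Lemma cantor_distE x y n : x n != y n -> agree n x y ->
  cantor_dist x y = radius n.
Proof.
move=> xyn xy; rewrite /cantor_dist; case: pselect => [h|]; last by case; exists n.
case: ex_minnP => m xym /(_ n xyn); rewrite leq_eqVlt => /orP[/eqP->//|/xy].
by move/eqP; rewrite (negPf xym).
Qed.

Variant cantor_dist_spec x y : R -> Prop :=
| CantorDistEq of x = y : cantor_dist_spec x y 0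
| CantorDistNeq n of x n != y n & agree n x y : cantor_dist_spec x y (radius n).

Lemma cantor_distP x y : cantor_dist_spec x y (cantor_dist x y).
Proof.
rewrite /cantor_dist; case: pselect => [h|/forallNP xy].
  case: ex_minnP => n xyn nmin; apply: CantorDistNeq => // i.
  by apply: contraPP => /eqP/nmin; rewrite leqNgt => /negP.
apply: CantorDistEq; apply/funext => n; apply/eqP/negPn/negP; exact: xy.
Qed.

Lemma cantor_dist_ge0 x y : 0 <= cantor_dist x y.
Proof. by case: cantor_distP => // n _ _; exact/ltW/radius_gt0. Qed.

Lemma radius_le m n : (m <= n)%N -> radius n <= radius m :> R.
Proof. by move=> mn; rewrite lef_pV2 ?posrE// ler_nat. Qed.

Lemma radius_le_cantor_dist x y n : x n != y n -> radius n <= cantor_dist x y.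
Proof.
case: cantor_distP => [->|m xym xy xyn]; first by rewrite eqxx.
by apply: radius_le; rewrite leqNgt; apply: contra xyn => /xy ->.
Qed.

Lemma cantor_dist_lt x y n : cantor_dist x y < radius n <-> agree n.+1 x y.
Proof.
split=> [xy i|xy].
  rewrite ltnS => ile; apply/eqP; apply: contraLR xy => /radius_le_cantor_dist.
  by rewrite -leNgt; apply: le_trans; exact: radius_le.
case: cantor_distP => [_|m xym _]; first exact: radius_gt0.
rewrite ltf_pV2 ?posrE// ltr_nat ltnS ltnNge -ltnS; apply: contra xym => ?.
by apply/eqP/xy.
Qed.

Lemma cantor_distxx x : cantor_dist x x = 0.
Proof. by case: cantor_distP => // n; rewrite eqxx. Qed.

Lemma cantor_dist_positivity x y : cantor_dist x y = 0 -> x = y.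
Proof. by case: cantor_distP => // n _ _ /eqP; rewrite gt_eqF// radius_gt0. Qed.

Lemma cantor_dist_sym x y : cantor_dist x y = cantor_dist y x.
Proof.
case: (cantor_distP x y) => [->|n xyn xy]; first by rewrite cantor_distxx.
by rewrite (@cantor_distE y x n)// 1?eq_sym// => i /xy.
Qed.

Lemma cantor_dist_triangle y x z :
  cantor_dist x z <= cantor_dist x y + cantor_dist y z.
Proof.
case: (cantor_distP x z) => [_|n xzn _]; first by rewrite addr_ge0// cantor_dist_ge0.
have [xyn|xyn] := eqVneq (x n) (y n).
  rewrite ler_wpDl ?cantor_dist_ge0//; apply: radius_le_cantor_dist.
  by rewrite -xyn.
by rewrite ler_wpDr ?cantor_dist_ge0//; exact: radius_le_cantor_dist.
Qed.

End CantorMetric.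

(** The parameter [R] serves to attach the metric with values in [R]. *)
Definition cantor_metric (R : realType) : Type := nat -> bool.

Section CantorPolish.
Local Open Scope ring_scope.
Context {R : realType}.

HB.instance Definition _ := Choice.on (cantor_metric R).
HB.instance Definition _ := @isMetric.Build R (cantor_metric R)
  (@cantor_dist R) cantor_distxx cantor_dist_positivity cantor_dist_sym
  cantor_dist_triangle.

Lemma nbhs_cantor_metric (x : cantor_metric R) (U : set (cantor_metric R)) :
  nbhs x U <-> exists n, forall y, agree n x y -> U y.
Proof.
rewrite -(@metricType_numDomainType.filter_from_mdist_nbhs R (cantor_metric R) x).
split=> [[e /= /radius_small[n ne] eU]|[n nU]].
  exists n.+1 => y /(@cantor_dist_lt R) xy; apply: eU.
  exact: lt_trans xy (ne n (leqnn n)).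
exists (radius n) => [|y /= /(@cantor_dist_lt R) xy]; first exact: radius_gt0.
by apply: nU => i /ltnW; exact: xy.
Qed.

Lemma cantor_metric_borelE : <<s @open (cantor_metric R) >> = @borel_seq bool.
Proof.
apply: borel_from_cylinders => [i b|U oU x Ux].
  rewrite openE => x /= xi; apply/nbhs_cantor_metric; exists i.+1 => y xy /=.
  by rewrite -xy.
by apply/nbhs_cantor_metric; exact: open_nbhs_nbhs.
Qed.

Lemma cantor_metric_polish : polish (cantor_metric R).
Proof.
split=> [F FF /cauchyP Fc|].
  have /(_ _)/cid-/all_sig[u uP] n : exists u, F [set y | agree n.+1 u y].
    have [u Fu] := Fc _ (radius_gt0 n); exists u; apply: filterS Fu => y.
    by rewrite ballEmdist => /(@cantor_dist_lt R).
  exists (fun n => u n n) => U /nbhs_cantor_metric[n nU].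
  suff : F [set y | agree n (fun n => u n n) y] by exact: filterS.
  elim: n {nU} => [|n IH]; first by apply: filterS filterT.
  apply: filterS (filterI IH (uP n)) => y [ny uy] i.
  by rewrite ltnS leq_eqVlt => /orP[/eqP->|/ny//]; exact: uy.
exists (range (fun s : seq bool => nth false s : cantor_metric R)).
  by apply: sub_countable (card_image_le _ _) _; exact: countableP.
move=> U [x Ux] oU; have : nbhs x U by exact: open_nbhs_nbhs.
move=> /nbhs_cantor_metric[n nU]; exists (nth false (mkseq x n)); split.
  by apply: nU => i ilt; rewrite nth_mkseq.
by exists (mkseq x n).
Qed.

Lemma standard_borel_cantor : standard_borel R borel_cantor.
Proof.
exists (cantor_metric R), id; split; first exact: cantor_metric_polish.
  by exists id.
by move=> A; rewrite image_id /measurable/= cantor_borelE cantor_metric_borelE.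
Qed.

End CantorPolish.

(** * The equivalence *)

Theorem theorem3p5 (R : realType) (pairing : nat -> nat -> nat)
    (pairing_bij : computable_bijection pairing) :
  hyper_recursively_finite pairing <->
  (forall (d : measure_display) (X : measurableType d)
     (E : X -> X -> Prop),
     standard_borel R X -> countable_borel_equivalence E ->
     hyper_borel_finite E).
Proof.
split; first exact: turing_hyper_borel_finite.
move=> hbf; apply: (hbf _ borel_cantor).
- exact: standard_borel_cantor.
- exact: turing_countable_borel.
- exact: borel_turing_seq.
Qed.
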